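(* Let $\alpha=2$, let $N\ge4$ be even, and write $x\in\mathbb{R}^N=\mathbb{R}^{N/2}\times\mathbb{R}^{N/2}$ as $x=(x',x'')$ with $x',x''\in\mathbb{R}^{N/2}$. Then, for any $a\in\mathbb{R}$, the function $$u(x)=u(|x'|,|x''|)=\frac{1}{\left(1+|x|^4-2a(|x'|^2-|x''|^2)+a^2\right)^{\frac{N-2}{4}}}$$ is a solution of $$-\Delta u=(N+2)(N-2)\,|x|^{2}\,u^{\frac{N+6}{N-2}}\ \text{ in }\mathbb{R}^N,\qquad u>0\ \text{ in }\mathbb{R}^N,\qquad u\in D^{1,2}(\mathbb{R}^N),$$ and these functions, as $a$ varies in $\mathbb{R}$, form a branch of solutions bifurcating from $U_2$.
   Context: $D^{1,2}(\mathbb{R}^N)=\{u\in L^{2N/(N-2)}(\mathbb{R}^N): |\nabla u|\in L^2(\mathbb{R}^N)\}$. $U_2(x)=(1+|x|^4)^{-\frac{N-2}{4}}$ is the radial solution of the problem with value $1$ at the origin. Fix $\beta$ with $\frac{N}{N+2}(N-2)<\beta<N-2$ and let $X=D^{1,2}(\mathbb{R}^N)\cap\{g\in L^\infty(\mathbb{R}^N):\|g\|_\beta<\infty\}$ with $\|g\|_\beta=\sup_x(1+|x|)^\beta|g(x)|$ and norm $\|g\|_X=\max\{\|\nabla g\|_{L^2},\|g\|_\beta\}$. ''Branch bifurcating from $U_2$'' means: the family depends continuously on $a$ in $X$, equals $U_2$ at $a=0$, and consists of nonradial functions for $a\ne0$. *)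

(* Defs.v *)
From HB Require Import structures.
From mathcomp Require Import all_boot all_order all_algebra.
From mathcomp Require Import all_classical all_reals all_analysis.

Set Implicit Arguments.
Unset Strict Implicit.
Unset Printing Implicit Defensive.

Import Order.TTheory GRing.Theory Num.Theory.
Import numFieldNormedType.Exports.

Local Open Scope classical_set_scope.
Local Open Scope ring_scope.

(* The sigma-algebra generated by the coordinate functions, as the library does
   for tuples; it is the Borel sigma-algebra of R^n. *)
Section measurable_rV.
Context {R : realType} (n : nat).

Let coor : 'I_n -> 'rV[R]_n -> measurableTypeR R := fun i x => x 0 i.

Let rV_set0 : g_sigma_preimage coor set0.
Proof. exact: sigma_algebra0. Qed.

Let rV_setC A : g_sigma_preimage coor A -> g_sigma_preimage coor (~` A).
Proof. exact: sigma_algebraC. Qed.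

Let rV_bigcup (F : (set 'rV[R]_n)^nat) : (forall i, g_sigma_preimage coor (F i)) ->
  g_sigma_preimage coor (\bigcup_i (F i)).
Proof. exact: sigma_algebra_bigcup. Qed.

HB.instance Definition _ := @isMeasurable.Build default_measure_display
  'rV[R]_n (g_sigma_preimage coor) rV_set0 rV_setC rV_bigcup.

End measurable_rV.

Section lebesgue_rV.
Context {R : realType}.

Definition rV_snoc n (p : 'rV[R]_n * measurableTypeR R) : 'rV[R]_n.+1 :=
  \row_i oapp (p.1 0) p.2 (unlift ord_max i).

Lemma measurable_coor n (i : 'I_n) :
  measurable_fun [set: 'rV[R]_n] (fun x => x 0 i : measurableTypeR R).
Proof.
move=> _ Y mY; rewrite setTI; apply: sub_sigma_algebra => /=.
rewrite -bigcup_seq/=; exists i => /=; first by rewrite mem_index_enum.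
by exists Y => //; rewrite setTI.
Qed.

Lemma measurable_rV_snoc n : measurable_fun setT (@rV_snoc n).
Proof.
apply: (@measurability _ _ _ _ setT (@rV_snoc n) _ erefl).
move=> _ [A + <-]; rewrite -bigcup_seq /= => -[i _ [B mB <-]].
rewrite !setTI -comp_preimage -[X in measurable X]setTI.
suff : measurable_fun setT
    (fun p : 'rV[R]_n * measurableTypeR R => rV_snoc p 0 i : measurableTypeR R).
  by move=> /(_ measurableT _ mB).
rewrite (_ : (fun p => _) = (fun p : 'rV[R]_n * measurableTypeR R =>
    oapp (p.1 0) p.2 (unlift ord_max i))); last first.
  by apply/funext => p; rewrite mxE.
case: unliftP => [j|] _ /=; last exact: measurable_snd.
exact: (measurableT_comp (measurable_coor j) measurable_fst).
Qed.

(* The pushforward of [m \x lebesgue_measure] under [rV_snoc]; the head symbol is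
   the library's measure structure on [pushforward], which takes the proof that
   the function is measurable. *)
Definition lebesgue_rV_step n (m : {measure set 'rV[R]_n -> \bar R}) :
    {measure set 'rV[R]_n.+1 -> \bar R} :=
  measure_function_pushforward__canonical__measure_function_Measure
    (m \x lebesgue_measure)%E (@measurable_rV_snoc n).

Fixpoint lebesgue_rV n : {measure set 'rV[R]_n -> \bar R} :=
  match n with
  | 0 => dirac (0 : 'rV[R]_0)
  | k.+1 => lebesgue_rV_step (lebesgue_rV k)
  end.

Lemma lebesgue_rV_box n (a b : 'I_n -> R) :
  lebesgue_rV n [set x | forall i, `[a i, b i]%classic (x 0 i)] =
  (\prod_(i < n) lebesgue_measure `[a i, b i]%classic)%E.
Proof.
elim: n a b => [|n IH] a b.
  by rewrite big_ord0 /= diracE mem_set // => -[].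
have liftW (i : 'I_n) : lift ord_max i = widen_ord (leqnSn n) i.
  by apply/val_inj; rewrite /= /bump leqNgt ltn_ord add0n.
pose w := widen_ord (leqnSn n).
rewrite big_ord_recr /= -(IH (a \o w) (b \o w)) -product_measure1E.
- rewrite /= /pushforward; congr (_ _); apply/seteqP.
  split => [[p q] /= H|[p q] /= [H1 H2] i]; last first.
    rewrite mxE; case: unliftP => [j ->|->] //=.
    by rewrite liftW; exact: H1.
  split => [i|]; last by have := H ord_max; rewrite mxE unlift_none.
  by have := H (lift ord_max i); rewrite mxE liftK liftW.
- rewrite [X in measurable X](_ : _ = \big[setI/setT]_(i < n)
      ((fun x : 'rV[R]_n => x 0 i : measurableTypeR R)
        @^-1` `[a (w i), b (w i)]%classic)); last first.
    rewrite -bigcap_seq; apply/seteqP; split=> x /= H i.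
      by move=> _; exact: H.
    by apply: (H i); rewrite /= mem_index_enum.
  apply: bigsetI_measurable => i _; rewrite -[X in measurable X]setTI.
  by apply: measurable_coor => //; exact: measurable_itv.
- exact: measurable_itv.
Qed.

End lebesgue_rV.

Section calculus.
Context {R : realType} {n : nat}.
Implicit Types (u phi : 'rV[R]_n -> R) (G : 'rV[R]_n -> 'rV[R]_n).

(* The Euclidean norm; [`|x|] is the sup norm on ['rV[R]_n] (same topology). *)
Definition enorm (x : 'rV[R]_n) : R := Num.sqrt (\sum_(i < n) x 0 i ^+ 2).

Definition partial (i : 'I_n) u : 'rV[R]_n -> R :=
  fun x => 'D_(delta_mx 0 i) u x.

Fixpoint Ck (k : nat) u : Prop :=
  continuous u /\
  match k with
  | 0 => True
  | l.+1 => forall i : 'I_n,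
      (forall x, derivable u x (delta_mx 0 i)) /\ Ck l (partial i u)
  end.

Definition laplacian u (x : 'rV[R]_n) : R :=
  \sum_(i < n) partial i (partial i u) x.

Definition radial u : Prop := forall x y, enorm x = enorm y -> u x = u y.

Definition test_function phi : Prop :=
  (forall k, Ck k phi) /\ exists r : R, forall x, r < enorm x -> phi x = 0.

Definition locally_integrable_rV u : Prop :=
  measurable_fun [set: 'rV[R]_n] u /\
  forall r : R, (lebesgue_rV n).-integrable [set x | enorm x <= r] (EFin \o u).

Definition weak_gradient u G : Prop :=
  [/\ locally_integrable_rV u,
      forall i, locally_integrable_rV (fun x => G x 0 i) &
      forall i phi, test_function phi ->
        (\int[lebesgue_rV n]_x (u x * partial i phi x))%R =
        - (\int[lebesgue_rV n]_x (G x 0 i * phi x))%R].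

Definition D12 u : Prop :=
  u \in Lfun (lebesgue_rV n) (2 * n%:R / (n%:R - 2))%:E /\
  exists2 G, weak_gradient u G & enorm \o G \in Lfun (lebesgue_rV n) 2%:E.

(* The L^2 norm of the weak gradient: two weak gradients of [u] agree almost
   everywhere, so the infimum is over at most one value; it is [+oo] when [u]
   has no weak gradient. *)
Definition grad_norm u : \bar R :=
  ereal_inf [set 'N[lebesgue_rV n]_2%:E[EFin \o (enorm \o G)]%E
            | G in weak_gradient u].

(* A pointwise supremum, not an essential one. *)
Definition beta_norm (beta : R) u : \bar R :=
  ereal_sup (range (fun x => ((1 + enorm x) `^ beta * `|u x|)%:E)).

Definition spaceX (beta : R) u : Prop :=
  [/\ D12 u, u \in Lfun (lebesgue_rV n) +oo%E & (beta_norm beta u < +oo)%E].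

Definition normX (beta : R) u : \bar R :=
  maxe (grad_norm u) (beta_norm beta u).

(* Classical solutions of - Delta u = (n + 2) (n - 2) |x|^2 u^((n + 6) / (n - 2)). *)
Definition solution u : Prop :=
  [/\ Ck 2 u,
      forall x, - laplacian u x =
        (n%:R + 2) * (n%:R - 2) * enorm x ^+ 2
          * u x `^ ((n%:R + 6) / (n%:R - 2)),
      forall x, 0 < u x &
      D12 u].

Definition U2 (x : 'rV[R]_n) : R :=
  (1 + enorm x ^+ 4) `^ (- ((n%:R - 2) / 4)).

Definition bifurcating_branch (beta : R) (F : R -> 'rV[R]_n -> R)
    (U : 'rV[R]_n -> R) : Prop :=
  [/\ forall a, solution (F a) /\ spaceX beta (F a),
      forall a0, normX beta (F a \- F a0) @[a --> a0] --> 0%E,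
      F 0 = U &
      forall a, a != 0 -> ~ radial (F a)].

End calculus.

Section family.
Context {R : realType} {n : nat}.

Lemma fst_half_subproof : (n./2 <= n)%N.
Proof. by rewrite -{2}(odd_double_half n) -addnn addnA leq_addl. Qed.

Lemma snd_half_subproof (j : 'I_n./2) : (n./2 + j < n)%N.
Proof.
apply: (@leq_trans (n./2 + n./2)%N); first by rewrite ltn_add2l.
by rewrite -{3}(odd_double_half n) -addnn leq_addl.
Qed.

(* The components [x'] and [x''] of [x] in [R^n = R^(n/2) * R^(n/2)]
   (for [n] even). *)
Definition fst_half (x : 'rV[R]_n) : 'rV[R]_n./2 :=
  \row_j x 0 (widen_ord fst_half_subproof j).

Definition snd_half (x : 'rV[R]_n) : 'rV[R]_n./2 :=
  \row_j x 0 (Ordinal (snd_half_subproof j)).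

Definition u_branch (a : R) (x : 'rV[R]_n) : R :=
  1 / (1 + enorm x ^+ 4
       - 2 * a * (enorm (fst_half x) ^+ 2 - enorm (snd_half x) ^+ 2)
       + a ^+ 2) `^ ((n%:R - 2) / 4).

End family.

(* Main.v *)
(** The denominator is [D = 1 + rho^2 - 2 a S + a^2] with [rho = |x|^2] and
    [S = |x'|^2 - |x''|^2].  As the two halves have the same dimension,
    [S] is harmonic, so [Delta D = 4 (N + 2) rho], and
    [|grad D|^2 = 16 rho (D - 1)]; inserted in the Laplacian of [D^-m] with
    [m = (N - 2) / 4], the terms containing [rho D] cancel, which is the equation.
    Moreover [D >= 1 + (rho - |a|)^2], so for [|a| <= A] one has [D >= c (1 + rho)^2].
    This gives polynomial decay of [u_a] and of its gradient, and, by the mean value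
    theorem, of the increments of both in [a] up to a factor [|a - a0|]: hence the
    membership in [D^{1,2}] and [X] and the continuity in [a].  Integrability reduces to
    dimension one, because [(1 + rho)^N] dominates the product of the [1 + x_i^2].  The
    classical gradient is a weak one by Fubini and the fundamental theorem of calculus. *)

From HB Require Import structures.

Require Import Defs.
From mathcomp Require Import all_boot all_order all_algebra.
From mathcomp Require Import ring lra.
From mathcomp Require Import all_classical all_reals all_analysis.
From mathcomp Require Import measurable_realfun ess_sup_inf.

Set Implicit Arguments.
Unset Strict Implicit.
Unset Printing Implicit Defensive.

Import Order.TTheory GRing.Theory Num.Theory.
Import numFieldNormedType.Exports.

Local Open Scope classical_set_scope.
Local Open Scope ring_scope.

(** * Fubini's theorem and continuous functions on row vectors *)

Section measure_rV.
Context {R : realType}.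
Notation leb := (@lebesgue_measure R).

Lemma measurable_box n (a b : 'I_n -> R) :
  measurable [set x : 'rV[R]_n | forall i, `[a i, b i]%classic (x 0 i)].
Proof.
rewrite (_ : mkset _ = \bigcap_(i in [set: 'I_n])
   ((fun x : 'rV[R]_n => x 0 i : measurableTypeR R) @^-1` `[a i, b i]%classic)).
  apply: fin_bigcap_measurable => // i _.
  rewrite -[X in measurable X]setTI.
  by apply: measurable_coor => //; exact: measurable_itv.
by apply/seteqP; split => x /= H i; [move=> _; exact: H|exact: (H i I)].
Qed.

Lemma prod_lebesgue_itv_lty n (a b : 'I_n -> R) :
  (\prod_(i < n) leb `[a i, b i]%classic < +oo)%E.
Proof.
set p := (X in (X < _)%E); suff /andP[] : (0 <= p < +oo)%E by [].
rewrite {}/p; apply: (big_ind (fun x : \bar R => (0 <= x < +oo)%E)).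
- by rewrite lee01 ltry.
- move=> x y /andP[x0 xoo] /andP[y0 yoo].
  by rewrite mule_ge0// lte_mul_pinfty// ge0_fin_numE.
- move=> i _; rewrite measure_ge0/=; apply: compact_finite_measure.
  exact: segment_compact.
Qed.

(** The cubes of half-width [k] exhaust the space and have finite measure by [lebesgue_rV_box].
    Iterated integration in either order rests on this. *)
Lemma sigma_finite_lebesgue_rV n : sigma_finite setT (@lebesgue_rV R n).
Proof.
exists (fun k => [set x : 'rV[R]_n | forall i, `[- k%:R, k%:R]%classic (x 0 i)]).
  apply/esym/seteqP; split => // x _.
  (* The sum of the absolute values bounds every coordinate at once. *)
  exists (Num.truncn (\sum_i `|x 0 i|)).+1 => //= i.
  rewrite in_itv/= -ler_norml; apply: (@le_trans _ _ (\sum_i `|x 0 i|)).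
    by rewrite (bigD1 i)//= lerDl sumr_ge0.
  exact/ltW/truncnS_gt.
move=> k; split; first exact: (measurable_box (fun=> - k%:R) (fun=> k%:R)).
rewrite (lebesgue_rV_box (fun=> - k%:R) (fun=> k%:R)).
exact: (prod_lebesgue_itv_lty (fun=> - k%:R) (fun=> k%:R)).
Qed.
End measure_rV.

Section sigma_finite_structure.
Context d (T : measurableType d) (R : realType) (m : {measure set T -> \bar R}).
Hypothesis sf : sigma_finite setT m.

(* The key of a canonical structure: the structure [m] of a measure cannot itself be
   extended by the proof of sigma-finiteness, but this alias of it can. *)
Definition as_sigma_finite of sigma_finite setT m : set T -> \bar R := m.

HB.instance Definition _ := isMeasure.Build d T R (as_sigma_finite sf)
  (measure0 m) (measure_ge0 m) (@measure_semi_sigma_additive _ _ _ m).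

HB.instance Definition _ :=
  Measure_isSigmaFinite.Build d T R (as_sigma_finite sf) sf.

End sigma_finite_structure.

Section fubini_rV.
Context {R : realType} (n : nat).
Local Open Scope ereal_scope.
Notation leb := (@lebesgue_measure R).
Let m : {sigma_finite_measure set 'rV[R]_n -> \bar R} :=
  as_sigma_finite (@sigma_finite_lebesgue_rV R n).

Lemma ge0_integral_rV_snoc (f : 'rV[R]_n.+1 -> \bar R) :
  measurable_fun [set: 'rV[R]_n.+1] f -> (forall x, 0 <= f x) ->
  \int[lebesgue_rV n.+1]_x f x =
  \int[lebesgue_rV n]_x \int[leb]_t f (rV_snoc (x, t)).
Proof.
move=> mf f0.
rewrite [LHS](ge0_integral_pushforward (@measurable_rV_snoc R n) (m \x leb))//.
rewrite preimage_setT (fubini_tonelli1 (m1 := m) (f \o @rV_snoc R n))//=.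
exact: measurableT_comp (@measurable_rV_snoc R n).
Qed.

Lemma integrable_rV_snoc (f : 'rV[R]_n.+1 -> \bar R) :
  (lebesgue_rV n.+1).-integrable setT f ->
  (m \x leb).-integrable setT (f \o @rV_snoc R n).
Proof.
move=> /integrableP[mf foo]; apply/integrableP; split.
  exact: measurableT_comp (@measurable_rV_snoc R n).
move: foo.
rewrite [X in X < _](ge0_integral_pushforward (@measurable_rV_snoc R n) (m \x leb))//.
exact: measurableT_comp.
Qed.

Lemma integral_rV_snoc (f : 'rV[R]_n.+1 -> \bar R) :
  (lebesgue_rV n.+1).-integrable setT f ->
  \int[lebesgue_rV n.+1]_x f x =
  \int[lebesgue_rV n]_x \int[leb]_t f (rV_snoc (x, t)).
Proof.
move=> fi; have fsi := integrable_rV_snoc fi; case/integrableP : fi => mf _.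
rewrite [LHS](integral_pushforward (@measurable_rV_snoc R n) (mu := m \x leb))//.
by rewrite preimage_setT -(integral12_prod_meas1 (m1 := m))//.
Qed.

(** With the last coordinate outermost, the inner integrals are over slices of dimension [n], to
    which an induction hypothesis applies. *)
Lemma integral_rV_snocC (f : 'rV[R]_n.+1 -> \bar R) :
  (lebesgue_rV n.+1).-integrable setT f ->
  \int[lebesgue_rV n.+1]_x f x =
  \int[leb]_t \int[lebesgue_rV n]_x f (rV_snoc (x, t)).
Proof.
move=> fi; have fsi := integrable_rV_snoc fi; case/integrableP : fi => mf _.
rewrite [LHS](integral_pushforward (@measurable_rV_snoc R n) (mu := m \x leb))//.
by rewrite preimage_setT -(integral21_prod_meas1 (m1 := m))//.
Qed.
End fubini_rV.

Section continuous_rV.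
Context {R : realType} (n : nat).
Implicit Types (f : 'rV[R]_n -> R) (r : R).

(* [f] is the pointwise limit of its values at the lattice points
   [floor ((k + 1) x) / (k + 1)], which form a countable set. *)
Lemma measurable_continuous_rV f : continuous f -> measurable_fun [set: 'rV[R]_n] f.
Proof.
move=> cf.
pose pt k (z : 'rV[int]_n) : 'rV[R]_n := \row_i ((z 0 i)%:~R / k.+1%:R).
pose dz k (x : 'rV[R]_n) : 'rV[int]_n := \row_i Num.floor (x 0 i * k.+1%:R).
apply: (@measurable_fun_cvg _ _ _ _ (fun k => f \o pt k \o dz k)).
  move=> k _ Y mY; rewrite setTI.
  (* The approximation is constant on each lattice cell, so the preimage is the countable union of
     the cells whose lattice point is sent into [Y]. *)
  rewrite (_ : _ @^-1` _ = \bigcup_(z : 'rV[int]_n)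
     ([set x | Y (f (pt k z))] `&` \bigcap_(i in [set: 'I_n])
     ((fun x : 'rV[R]_n => x 0 i : measurableTypeR R) @^-1`
       ((fun t => t * k.+1%:R) @^-1` `[(z 0 i)%:~R, (z 0 i + 1)%:~R[%classic)))).
    apply: countable_bigcupT_measurable => [|z]; first exact: countableP.
    apply: measurableI.
      by have [h|h] := pselect (Y (f (pt k z)));
        [rewrite (_ : mkset _ = setT)//|rewrite (_ : mkset _ = set0)//];
        apply/seteqP; split.
    apply: fin_bigcap_measurable => // i _.
    rewrite -[X in measurable X]setTI.
    apply: measurable_coor => //.
    rewrite -[X in measurable X]setTI.
    have : measurable_fun setT (fun t : R => t * k.+1%:R) by exact: mulrr_measurable.
    by apply => //; exact: measurable_itv.
  apply/seteqP; split => [x /= Yx|x /= [z _ [/= Yz zx]]].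
    exists (dz k x) => //; split => //= i _ /=.
    by rewrite in_itv/= mxE floor_le/= lt_succ_floor.
  rewrite (_ : dz k x = z)//; apply/rowP => i; rewrite mxE.
  by apply: floor_def; have := zx i I; rewrite /= in_itv.
move=> x _; suff h : pt k (dz k x) @[k --> \oo] --> x.
  exact: (@cvg_comp _ _ _ (fun k => pt k (dz k x)) f _ _ _ h (cf x)).
apply/cvg_ballP => e e0; near=> k.
split=> // i j; rewrite /ball/= (ord1 i) !mxE.
have k0 : 0 < k.+1%:R :> R by rewrite ltr0n.
have /andP[fl fu] := floor_itv (x 0 j * k.+1%:R).
rewrite intrD in fu; set F := (Num.floor _)%:~R in fl fu *.
(* In each coordinate the error is a fractional part divided by [k.+1]. *)
have -> : x 0 j - F / k.+1%:R = (x 0 j * k.+1%:R - F) / k.+1%:R.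
  by rewrite mulrBl mulfK// gt_eqF.
have ek : k.+1%:R^-1 < e by near: k; exact: (near_infty_natSinv_lt (PosNum e0)).
rewrite ger0_norm; last by rewrite divr_ge0// subr_ge0.
apply: lt_trans ek; rewrite -[ltRHS]mul1r ltr_pM2r ?invr_gt0// ltrBlDl.
Unshelve. all: by end_near. Qed.

End continuous_rV.

(** * Directional derivatives on lines and slices *)

Section directional.
Context {R : realType}.

(** A directional derivative depends only on the restriction to a line: the two difference quotients
    are the same function of [h]. This carries derivatives to slices and to functions of one real
    variable. *)
Lemma derive_along (V V' : normedModType R) (f : V -> R) (g : V' -> R) x v y w :
  (forall h : R, f (h *: v + x) = g (h *: w + y)) ->
  (derivable f x v -> derivable g y w) /\ 'D_v f x = 'D_w g y.
Proof.
move=> fg; have fgxy : f x = g y by have := fg 0; rewrite !scale0r !add0r.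
have E : (fun h : R => h^-1 *: ((f \o shift x) (h *: v) - f x)) =
         (fun h : R => h^-1 *: ((g \o shift y) (h *: w) - g y)).
  by apply/funext => h /=; rewrite fgxy fg.
by rewrite /derivable /derive E.
Qed.

Lemma continuous_rV_snocl n (t : R) :
  continuous (fun x : 'rV[R]_n => rV_snoc (x, t)).
Proof.
move=> x; have FF := nbhs_filter x; apply/cvg_ballP => e e0; near=> y.
split=> // i j; rewrite !mxE; case: unliftP => [k _|_] /=; last exact: ballxx.
suff [] : ball x e y by move=> _; exact.
by near: y; exact: (@nbhsx_ballx R ('rV[R]_n) x e e0).
Unshelve. all: by end_near. Qed.

Lemma continuous_rV_snocr n (x : 'rV[R]_n) :
  continuous (fun t : R => rV_snoc (x, t)).
Proof.
move=> t; apply/cvg_ballP => e e0; near=> s.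
split=> // i j; rewrite !mxE; case: unliftP => [k _|_] /=; first exact: ballxx.
by near: s; exact: (@nbhsx_ballx R R t e e0).
Unshelve. all: by end_near. Qed.

Lemma rV_snoc_shiftl n (x : 'rV[R]_n) (t : R) (j : 'I_n) (h : R) :
  h *: delta_mx 0 (lift ord_max j) + rV_snoc (x, t) =
  rV_snoc (h *: delta_mx 0 j + x, t).
Proof.
apply/rowP => i; rewrite !mxE /=; case: unliftP => [k ->|->] /=.
  by rewrite !mxE (inj_eq (@lift_inj _ _)).
by rewrite (_ : _ == _ = false) ?mulr0 ?add0r//; exact/negbTE/neq_lift.
Qed.

Lemma rV_snoc_shiftr n (x : 'rV[R]_n) (t h : R) :
  h *: delta_mx 0 ord_max + rV_snoc (x, t) = rV_snoc (x, h + t).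
Proof.
apply/rowP => i; rewrite !mxE /=; case: unliftP => [k ->|->] /=.
  by rewrite eq_sym (negbTE (neq_lift _ _)) mulr0 add0r.
by rewrite eqxx mulr1.
Qed.

End directional.

(** * Integrals of partial derivatives of compactly supported functions *)

Section divergence.
Context {R : realType}.

Definition cube n (r : R) : set 'rV[R]_n := [set x | forall i, `[- r, r]%classic (x 0 i)].

Lemma cubePn n r (x : 'rV[R]_n) : ~ cube r x -> exists j, r < `|x 0 j|.
Proof.
move=> /existsNP[j]; rewrite /= in_itv/= -ler_norml => /negP; rewrite -ltNge.
by exists j.
Qed.

Lemma measurable_cube n r : measurable (@cube n r).
Proof. exact: (measurable_box (fun=> - r) (fun=> r)). Qed.

Lemma integrable_cube n (f : 'rV[R]_n -> R) r : continuous f ->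
  (lebesgue_rV n).-integrable (cube r) (EFin \o f).
Proof.
move=> cf; apply: measurable_bounded_integrable.
- exact: measurable_cube.
- rewrite [X in (X < _)%E](lebesgue_rV_box (fun=> - r) (fun=> r)).
  exact: prod_lebesgue_itv_lty.
- apply: measurable_funTS; exact: measurable_continuous_rV.
- have /compact_bounded : compact (f @` cube r).
    apply: continuous_compact; first exact: continuous_subspaceT.
    by apply: (@rV_compact _ n (fun=> `[- r, r]%classic)) => i; exact: segment_compact.
  move=> [M [Mr fM]]; exists M; split=> // y /fM h x cx; apply: h.
  by exists x.
Qed.

Lemma integrable_compact_support n (f : 'rV[R]_n -> R) r : continuous f ->
  (forall x, ~ cube r x -> f x = 0) ->
  (lebesgue_rV n).-integrable setT (EFin \o f).
Proof.
move=> cf f0.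
have := iffLR (integrable_mkcond _ (measurable_cube r)) (integrable_cube r cf).
congr integrable; apply/funext => x; rewrite patchE /=; case: ifPn => //.
by rewrite notin_setE => /f0 ->.
Qed.

(** The complement of the cube is open, since [r < |x_j|] persists nearby; so [f] agrees with zero
    in a neighbourhood of [x]. *)
Lemma partial_support n (f : 'rV[R]_n -> R) r i :
  (forall x, ~ cube r x -> f x = 0) ->
  forall x, ~ cube r x -> partial i f x = 0.
Proof.
move=> f0 x /cubePn[j rj].
rewrite /partial (_ : 'D_(delta_mx 0 i) f x = 'D_(delta_mx 0 i) (cst 0) x).
  exact: derive_cst.
have xj : \forall y \near x, r < `|(y : 'rV[R]_n) 0 j|.
  have cn : {for x, continuous (fun y : 'rV[R]_n => `|y 0 j|)}.
    by apply: continuous_comp; [exact: coord_continuous|exact: norm_continuous].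
  exact: (cvgr_gt _ cn _ rj).
apply: near_eq_derive; near=> y; rewrite f0//.
move=> /(_ j) /=; rewrite in_itv/= -ler_norml leNgt => /negP; apply.
by near: y.
Unshelve. all: by end_near. Qed.

(* Induction on the dimension.  If [i] is the last coordinate, integrate it first:
   the inner integral vanishes by the fundamental theorem of calculus.  Otherwise
   integrate the last coordinate last. *)
Lemma integral_partial_eq0 n (i : 'I_n) (f : 'rV[R]_n -> R) r :
  continuous f -> (forall x, derivable f x (delta_mx 0 i)) ->
  continuous (partial i f) -> (forall x, ~ cube r x -> f x = 0) ->
  (\int[lebesgue_rV n]_x (partial i f x)%:E = 0)%E.
Proof.
elim: n i f => [[]//|n IH] i f cf df cpf f0.
have fi : (lebesgue_rV n.+1).-integrable setT (EFin \o partial i f).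
  by apply: (@integrable_compact_support _ _ r) => //; exact: partial_support.
case: (unliftP ord_max i) cpf df fi => [j ->|->] cpf df fi.
  rewrite [LHS](integral_rV_snocC fi); apply: integral0_eq => t _ /=.
  have E x : (derivable f (rV_snoc (x, t)) (delta_mx 0 (lift ord_max j)) ->
              derivable (fun y => f (rV_snoc (y, t))) x (delta_mx 0 j)) /\
      partial (lift ord_max j) f (rV_snoc (x, t)) =
      partial j (fun y => f (rV_snoc (y, t))) x.
    by apply: derive_along => h; rewrite rV_snoc_shiftl.
  under eq_integral do rewrite (E _).2.
  apply: IH => //.
  - by move=> x; apply: continuous_comp; [exact: continuous_rV_snocl|exact: cf].
  - by move=> x; apply: (E x).1.
  - rewrite (_ : partial j _ = partial (lift ord_max j) f \o (fun x => rV_snoc (x, t))).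
      by move=> x; apply: continuous_comp; [exact: continuous_rV_snocl|exact: cpf].
    by apply/funext => x /=; rewrite (E x).2.
  - move=> x /cubePn[k rk]; apply: f0 => /(_ (lift ord_max k)) /=.
    by rewrite in_itv/= -ler_norml mxE liftK/= leNgt rk.
rewrite [LHS](integral_rV_snoc fi); apply: integral0_eq => x _ /=.
pose g t := f (rV_snoc (x, t)).
have E t : (derivable f (rV_snoc (x, t)) (delta_mx 0 ord_max) ->
            derivable g t 1) /\ partial ord_max f (rV_snoc (x, t)) = 'D_1 g t.
  by apply: derive_along => h; rewrite rV_snoc_shiftr /g /GRing.scale/= mulr1.
have dg t : derivable g t 1 by apply: (E t).1.
have cg : continuous g.
  by move=> t; apply: continuous_comp; [exact: continuous_rV_snocr|exact: cf].
have cg' : continuous (fun t => partial ord_max f (rV_snoc (x, t))).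
  by move=> t; apply: continuous_comp; [exact: continuous_rV_snocr|exact: cpf].
have out t : `|r| < `|t| -> ~ cube r (rV_snoc (x, t)).
  move=> rt /(_ ord_max) /=; rewrite in_itv/= -ler_norml mxE unlift_none/=.
  by rewrite leNgt (le_lt_trans (ler_norm r) rt).
(* As [r] may be negative, [|r| + 1] is taken: it is positive, and [g] vanishes at both endpoints
   [- a] and [a]. *)
pose a := `|r| + 1.
have a0 : 0 < a by rewrite ltr_wpDl.
have ra : `|r| < a by rewrite ltrDl.
have g0 t : a <= `|t| -> g t = 0 by move=> at'; apply/f0/out/(lt_le_trans ra).
transitivity (\int[lebesgue_measure]_(t in `[(- a)%R, a])
   (partial ord_max f (rV_snoc (x, t)))%:E)%E.
  rewrite [RHS]integral_mkcond; apply: eq_integral => t _.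
  rewrite patchE; case: ifPn => //; rewrite notin_setE /= in_itv/= -ler_norml.
  move=> /negP; rewrite -ltNge => at'.
  by rewrite (partial_support _ f0)//; apply: out; exact: lt_trans at'.
rewrite (@continuous_FTC2 _ _ g).
- by rewrite !g0 ?subee// ?normrN ler_norm.
- by rewrite gtrN.
- exact: continuous_subspaceT.
- split=> [t _//||]; [apply: cvg_at_right_filter|apply: cvg_at_left_filter]; exact: cg.
- by move=> t _; rewrite derive1E (E t).2.
Qed.

End divergence.
(** * An integrable majorant *)

Section decay.
Context {R : realType}.
Notation leb := (@lebesgue_measure R).

Lemma powR_continuous_at (a x : R) : 0 < x -> {for x, continuous (fun y => y `^ a)}.
Proof.
move=> x0; apply: differentiable_continuous; apply/derivable1_diffP.
exact: (ex_derive (is_derive := is_derive1_powR a x0)).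
Qed.

Lemma continuous_powR_comp (V : topologicalType) (g : V -> R) (a : R) :
  continuous g -> (forall x, 0 < g x) -> continuous (fun x => g x `^ a).
Proof.
move=> cg g0 x; apply: (@continuous_comp _ _ _ g (fun y => y `^ a)).
  exact: cg.
exact: powR_continuous_at.
Qed.

(** The exponent 3/2 exceeds 1, hence integrability on the line. It is also small enough for the
    branch: in dimension N it asks for a decay (1 + |x|^2)^(-3N/4), and the squared gradients, of
    order (1 + |x|^2)^(-(N - 1)), meet this because 3N/4 <= N - 1 for N >= 4. *)
Definition tail1 (t : R) : R := (1 + `|t|) `^ (- (3 / 2)).

Lemma tail1_gt0 t : 0 < tail1 t.
Proof. by rewrite powR_gt0// ltr_wpDr. Qed.

Lemma tail1_continuous : continuous tail1.
Proof.
apply: continuous_powR_comp => [t|t]; last by rewrite ltr_wpDr.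
by apply: cvgD; [exact: cvg_cst|exact: norm_continuous].
Qed.

(** By symmetry the half-line suffices, where -2 (1 + t)^(-1/2) is an antiderivative tending to
    0. *)
Lemma integral_tail1_lty : (\int[leb]_t (tail1 t)%:E < +oo)%E.
Proof.
rewrite ge0_symfun_integralT; last 3 first.
- by move=> t; exact/ltW/tail1_gt0.
- exact: tail1_continuous.
- by move=> t; rewrite /tail1/= normrN.
rewrite lte_mul_pinfty//.
rewrite (_ : [set x | _] = `[0, +oo[%classic); last first.
  by apply/seteqP; split => x /=; rewrite in_itv/= andbT.
pose F (t : R) : R := - 2 * (1 + t) `^ (- 2^-1).
have dF (t : R) : 0 <= t -> is_derive t 1 F (tail1 t).
  move=> t0; have t1 : 0 < 1 + t by rewrite ltr_wpDr.
  have d1 : is_derive t 1 (fun s : R => 1 + s) (1 : R).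
    have := is_deriveD (is_derive_cst (1 : R) t (1 : R)) (is_derive_id t (1 : R)).
    by rewrite add0r.
  have d2 := is_derive1_comp (is_derive1_powR (- 2^-1) t1) d1.
  have /is_derive_eq := @is_deriveZ _ _ _ _ (- 2 : R) _ _ _ d2; apply.
  rewrite /tail1 ger0_norm// /GRing.scale/= mulr1.
  rewrite (_ : - 2^-1 - 1 = - (3 / 2) :> R); last by field.
  by rewrite mulrA mulrNN mulfV ?mul1r.
rewrite (@ge0_continuous_FTC2y _ tail1 F 0 0).
- by rewrite -EFinB ltry.
- by move=> t _; exact/ltW/tail1_gt0.
- exact/continuous_subspaceT/tail1_continuous.
- rewrite -[X in _ --> X](mulr0 (- 2)); apply: cvgM; first exact: cvg_cst.
  under eq_fun do rewrite powRN.
  apply/gtr0_cvgV0; first by near=> t; rewrite powR_gt0// ltr_pwDl.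
  apply/cvgryPge => A; near=> t.
  have A2 : A ^+ 2 <= t by near: t; apply: nbhs_pinfty_ge; rewrite num_real.
  have t0 : 0 <= t by apply: le_trans A2; exact: sqr_ge0.
  rewrite powR12_sqrt ?addr_ge0// (le_trans (ler_norm A))// -sqrtr_sqr.
  by rewrite ler_wsqrtr// ler_wpDl.
- by move=> t /ltW /dF dt; exact: ex_derive.
- apply: cvg_at_right_filter; apply: differentiable_continuous.
  by apply/derivable1_diffP; have := dF 0 (lexx 0) => dt; exact: ex_derive.
- move=> t; rewrite in_itv/= andbT => /ltW /dF dt.
  by rewrite derive1E derive_val.
Unshelve. all: by end_near. Qed.

Definition tail n (x : 'rV[R]_n) : R := \prod_(i < n) tail1 (x 0 i).

Lemma tail_gt0 n (x : 'rV[R]_n) : 0 < tail x.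
Proof. by apply: prodr_gt0 => i _; exact: tail1_gt0. Qed.

Lemma tail_continuous n : continuous (@tail n).
Proof.
rewrite /tail; elim: (index_enum _) => [|i s IH].
  under eq_fun do rewrite big_nil.
  exact: cst_continuous.
under eq_fun do rewrite big_cons.
have ct : continuous (fun x : 'rV[R]_n => tail1 (x 0 i)).
  move=> x; apply: (@continuous_comp _ _ _ (fun x : 'rV[R]_n => x 0 i) tail1).
    exact: coord_continuous.
  exact: tail1_continuous.
by move=> x; exact: (continuousM (ct x) (IH x)).
Qed.

(** By Tonelli and induction on the dimension, the integral of the product splits into
    one-dimensional integrals. *)
Lemma integral_tail_lty n : (\int[lebesgue_rV n]_x (@tail n x)%:E < +oo)%E.
Proof.
have mt k : measurable_fun [set: 'rV[R]_k] (EFin \o @tail k).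
  by apply/measurable_EFinP; apply: measurable_continuous_rV; exact: tail_continuous.
have mt1 : measurable_fun setT (EFin \o tail1).
  apply/measurable_EFinP; apply: continuous_measurable_fun.
  exact: tail1_continuous.
elim: n => [|n IH].
  rewrite /= integral_dirac//=; last exact: (mt 0%N).
  by rewrite diracE in_setT mul1e ltry.
rewrite (ge0_integral_rV_snoc (mt n.+1)); last first.
  by move=> x; rewrite lee_fin ltW ?tail_gt0.
rewrite (eq_integral (fun x => (tail x)%:E * \int[leb]_t (tail1 t)%:E)%E); last first.
  move=> x _; rewrite -ge0_integralZl//.
  - apply: eq_integral => t _; rewrite /= -EFinM /tail big_ord_recr/=.
    rewrite mxE unlift_none/=; congr ((_ * _)%:E); apply: eq_bigr => i _.
    rewrite mxE (_ : widen_ord _ i = lift ord_max i) ?liftK//.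
    by apply/val_inj; rewrite /= /bump leqNgt ltn_ord add0n.
  - by move=> t _; rewrite lee_fin ltW ?tail1_gt0.
  - by rewrite lee_fin ltW ?tail_gt0.
rewrite ge0_integralZr//.
- rewrite lte_mul_pinfty ?integral_tail1_lty//.
  + by apply: integral_ge0 => x _; rewrite lee_fin ltW ?tail_gt0.
  + by rewrite ge0_fin_numE//; apply: integral_ge0 => x _; rewrite lee_fin ltW ?tail_gt0.
- exact: mt.
- by move=> x _; rewrite lee_fin ltW ?tail_gt0.
- by apply: integral_ge0 => x _; rewrite lee_fin ltW ?tail1_gt0.
Qed.

Definition rho n (x : 'rV[R]_n) : R := \sum_(i < n) x 0 i ^+ 2.

Lemma rho_ge0 n (x : 'rV[R]_n) : 0 <= rho x.
Proof. by apply: sumr_ge0 => i _; exact: sqr_ge0. Qed.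

Lemma coord_sqr_le_rho n (x : 'rV[R]_n) i : x 0 i ^+ 2 <= rho x.
Proof. by rewrite /rho (bigD1 i)//= lerDl sumr_ge0// => j _; exact: sqr_ge0. Qed.

Lemma rho_ge1 n (x : 'rV[R]_n) : 1 <= 1 + rho x.
Proof. by rewrite lerDl rho_ge0. Qed.

Lemma rho_gt0 n (x : 'rV[R]_n) : 0 < 1 + rho x.
Proof. exact: lt_le_trans (rho_ge1 x). Qed.

Lemma enorm_sqr n (x : 'rV[R]_n) : enorm x ^+ 2 = rho x.
Proof. by rewrite sqr_sqrtr// rho_ge0. Qed.

Lemma ge0_ler_powRN (a b s : R) : 0 <= s -> 0 < a -> a <= b -> b `^ (- s) <= a `^ (- s).
Proof.
move=> s0 a0 ab; have b0 := lt_le_trans a0 ab.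
by rewrite !powRN lef_pV2 ?posrE ?powR_gt0// ge0_ler_powR// nnegrE ltW.
Qed.

(** In each coordinate (1 + |x_i|)^2 <= 2 (1 + x_i^2) <= 2 (1 + rho). Raising to the power -3/4
    costs a factor 2^(3/4), and the [n] inequalities are multiplied. *)
Lemma decay_le_tail n (x : 'rV[R]_n) :
  (1 + rho x) `^ (- (3 / 4 * n%:R)) <= (2 `^ (3 / 4)) ^+ n * tail x.
Proof.
rewrite -mulNr powRrM powR_mulrn ?powR_ge0//.
have E (a : R) : a ^+ n = \prod_(i < n) a by rewrite prodr_const card_ord.
rewrite !E -big_split/=; apply: ler_prod => i _.
rewrite powR_ge0/= /tail1; set s : R := 3 / 4.
have -> : (1 + `|x 0 i|) `^ (- (3 / 2)) = ((1 + `|x 0 i|) ^+ 2) `^ (- s).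
  by rewrite -powR_mulrn ?addr_ge0// -powRrM; congr (_ `^ _); rewrite /s; field.
have -> : (1 + rho x) `^ (- s) = 2 `^ s * (2 * (1 + rho x)) `^ (- s).
  rewrite powRM ?addr_ge0 ?rho_ge0// mulrA [2 `^ (- s)]powRN mulfV ?mul1r//.
rewrite ler_pM2l ?powR_gt0//.
apply: ge0_ler_powRN; first by rewrite /s; lra.
  by rewrite exprn_gt0// ltr_wpDr.
have := coord_sqr_le_rho x i; rewrite -[x 0 i ^+ 2]real_normK ?num_real// => h.
have := sqr_ge0 (1 - `|x 0 i|); nra.
Qed.

Lemma integrable_decay n (f : 'rV[R]_n -> R) (C q : R) :
  measurable_fun [set: 'rV[R]_n] f -> 3 / 4 * n%:R <= q ->
  (forall x, `|f x| <= C * (1 + rho x) `^ (- q)) ->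
  (lebesgue_rV n).-integrable setT (EFin \o f).
Proof.
move=> mf nq fC.
(* The bound at the origin determines the sign of [C]. *)
have C0 : 0 <= C.
  have := le_trans (normr_ge0 _) (fC 0).
  by rewrite pmulr_lge0// powR_gt0// rho_gt0.
pose K := C * (2 `^ (3 / 4)) ^+ n.
have K0 : 0 <= K by rewrite mulr_ge0// exprn_ge0// powR_ge0.
have it : (lebesgue_rV n).-integrable setT (EFin \o @tail n).
  apply/integrableP; split.
    by apply/measurable_EFinP; apply: measurable_continuous_rV; exact: tail_continuous.
  under eq_integral do rewrite /= ger0_norm ?ltW ?tail_gt0//.
  exact: integral_tail_lty.
apply: (le_integrable measurableT _ _ (integrableZl measurableT K it)).
  exact/measurable_EFinP.
move=> x _ /=; rewrite lee_fin [leRHS]ger0_norm; last first.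
  by rewrite mulr_ge0// ltW ?tail_gt0.
apply: (le_trans (fC x)); rewrite -mulrA ler_wpM2l//.
apply: le_trans (decay_le_tail x); rewrite ler_powR ?rho_ge1//.
by rewrite lerN2.
Qed.

End decay.

(** * Continuously differentiable functions as Sobolev functions *)

Section sobolev.
Context {R : realType} (n : nat).
Implicit Types (u phi : 'rV[R]_n -> R) (x : 'rV[R]_n).

Lemma continuous_sum (V : topologicalType) (I : Type) (r : seq I) (f : I -> V -> R) :
  (forall i, continuous (f i)) -> continuous (fun y => \sum_(i <- r) f i y).
Proof.
move=> cf; elim: r => [|i s IH].
  by under eq_fun do rewrite big_nil; exact: cst_continuous.
under eq_fun do rewrite big_cons.
by move=> y; exact: (continuousD (cf i y) (IH y)).
Qed.

Lemma rho_continuous : continuous (@rho R n).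
Proof.
apply: continuous_sum => i x.
apply: (@continuous_comp _ _ _ (fun x : 'rV[R]_n => x 0 i) (fun t => t ^+ 2)).
  exact: coord_continuous.
exact: exprn_continuous.
Qed.

Lemma enorm_continuous : continuous (@enorm R n).
Proof.
move=> x; apply: (@continuous_comp _ _ _ (@rho R n) Num.sqrt).
  exact: rho_continuous.
exact: sqrt_continuous.
Qed.

Lemma coord_le_enorm x i : `|x 0 i| <= enorm x.
Proof.
by rewrite -[leLHS]sqrtr_sqr ler_wsqrtr// coord_sqr_le_rho.
Qed.

Lemma enorm_le_sum x : enorm x <= \sum_i `|x 0 i|.
Proof.
rewrite -[leRHS]ger0_norm ?sumr_ge0// -sqrtr_sqr ler_wsqrtr//.
elim: (index_enum _) => [|i s IH]; first by rewrite !big_nil expr0n.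
rewrite !big_cons sqrrD real_normK ?num_real// -addrA lerD2l.
by rewrite (le_trans IH)// lerDr mulrn_wge0// mulr_ge0// sumr_ge0.
Qed.

Lemma locally_integrable_continuous u : continuous u -> locally_integrable_rV u.
Proof.
move=> cu; split=> [|r]; first exact: measurable_continuous_rV.
apply: (@integrableS _ _ _ _ (cube r)).
- exact: measurable_cube.
- rewrite (_ : mkset _ = @enorm R n @^-1` `]-oo, r]%classic).
    rewrite -[X in measurable X]setTI.
    have := measurable_continuous_rV enorm_continuous.
    by apply => //; exact: measurable_itv.
  by apply/seteqP; split => x /=; rewrite in_itv.
- move=> x /= xr i; rewrite /= in_itv/= -ler_norml.
  exact: le_trans (coord_le_enorm x i) xr.
- exact: integrable_cube.
Qed.

(** Integration by parts: [u * phi] has compact support, so [integral_partial_eq0] applies to it,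
    and the product rule gives the identity. *)
Lemma weak_gradient_Ck1 u : Ck 1 u ->
  weak_gradient u (fun x => \row_i partial i u x).
Proof.
move=> [cu du]; split; first exact: locally_integrable_continuous.
  move=> i; under eq_fun do rewrite mxE.
  by apply: locally_integrable_continuous; case: (du i) => _ [].
move=> i phi [/(_ 1) [cphi /(_ i)[dphi [cdphi _]]] [r phi0]].
have {du} [du [cdu _]] := du i.
under [in RHS]eq_Rintegral do rewrite mxE.
have phi0' x : ~ cube r x -> phi x = 0.
  by move=> /cubePn[j rj]; apply: phi0; exact: lt_le_trans (coord_le_enorm x j).
have dphi0 := partial_support i phi0'.
have i1 : (lebesgue_rV n).-integrable setT (EFin \o (fun x => u x * partial i phi x)).
  apply: (@integrable_compact_support _ _ _ r).
    by move=> x; exact: (continuousM (cu x) (cdphi x)).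
  by move=> x /dphi0 ->; rewrite mulr0.
have i2 : (lebesgue_rV n).-integrable setT (EFin \o (fun x => partial i u x * phi x)).
  apply: (@integrable_compact_support _ _ _ r).
    by move=> x; exact: (continuousM (cdu x) (cphi x)).
  by move=> x /phi0' ->; rewrite mulr0.
have dM x : is_derive x (delta_mx 0 i) (u * phi)
    (u x * partial i phi x + partial i u x * phi x).
  have := is_deriveM (derivableP (du x)) (derivableP (dphi x)).
  by rewrite /GRing.scale/= [phi x * _]mulrC.
have pE : partial i (u * phi) = fun x => u x * partial i phi x + partial i u x * phi x.
  by apply/funext => x; rewrite /partial derive_val.
(* The two sides differ by the integral of the partial derivative of [u * phi]. *)
apply/eqP; rewrite -subr_eq0 opprK -RintegralD//.
rewrite /Rintegral.
rewrite -[X in fine X](_ : (\int[lebesgue_rV n]_x (partial i (u * phi) x)%:E)%E = _).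
  rewrite (@integral_partial_eq0 _ _ _ _ r)//.
  - by move=> x; exact: (continuousM (cu x) (cphi x)).
  - rewrite pE => x.
    exact: (continuousD (continuousM (cu x) (cdphi x)) (continuousM (cdu x) (cphi x))).
  - by move=> x /phi0' /= p0; rewrite /GRing.mul/= p0 mulr0.
by rewrite pE.
Qed.

(** The common scale of all estimates: of order |x|^(-2q) at infinity, with exponents that add under
    multiplication. Negative [q] serves for growing factors. *)
Definition decay (q : R) x : R := (1 + rho x) `^ (- q).

Lemma decay_gt0 q x : 0 < decay q x.
Proof. by rewrite powR_gt0// rho_gt0. Qed.

Lemma decay_continuous q : continuous (decay q).
Proof.
apply: continuous_powR_comp; last exact: rho_gt0.
move=> x; apply: (@continuous_comp _ _ _ (@rho R n) (fun t => 1 + t)).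
  exact: rho_continuous.
by apply: cvgD; [exact: cvg_cst|exact: cvg_id].
Qed.

Lemma Lnorm_decay_lty (p q : R) : 1 <= p -> 3 / 4 * n%:R <= q * p ->
  ('N[lebesgue_rV n]_p%:E[EFin \o decay q] < +oo)%E.
Proof.
move=> p1 npq; have p0 : 0 < p by apply: lt_le_trans p1.
rewrite unlock /Lnorm; apply: poweR_lty.
have /integrableP[_] : (lebesgue_rV n).-integrable setT (EFin \o decay (q * p)).
  apply: (@integrable_decay _ _ _ 1 (q * p)) => //.
    exact: (measurable_continuous_rV (@decay_continuous _)).
  by move=> x; rewrite mul1r ger0_norm// powR_ge0.
congr (_ < _)%E; apply: eq_integral => x _ /=.
by rewrite !ger0_norm ?powR_ge0// -powRrM mulNr.
Qed.

(** The constant is kept explicit: taken proportional to |a - a0|, it yields the continuity of the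
    branch. *)
Lemma Lnorm_le_decay (g : 'rV[R]_n -> R) (p q C : R) : 1 <= p -> 0 <= C ->
  measurable_fun [set: 'rV[R]_n] g -> (forall x, `|g x| <= C * decay q x) ->
  ('N[lebesgue_rV n]_p%:E[EFin \o g] <=
   C%:E * 'N[lebesgue_rV n]_p%:E[EFin \o decay q])%E.
Proof.
move=> p1 C0 mg gC; have p0 : 0 < p by apply: lt_le_trans p1.
have mr : measurable_fun [set: 'rV[R]_n] (decay q).
  exact: (measurable_continuous_rV (@decay_continuous _)).
have mp (h : 'rV[R]_n -> R) : measurable_fun [set: 'rV[R]_n] h ->
    measurable_fun [set: 'rV[R]_n] (fun x => `|(EFin \o h) x| `^ p)%E.
  move=> mh; rewrite (_ : (fun x => _) = EFin \o (fun x => `|h x| `^ p)).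
    apply/measurable_EFinP; apply: (measurableT_comp (measurable_powR p)).
    exact: measurableT_comp.
  by apply/funext.
rewrite unlock /Lnorm.
(* Written as a [p]-th root, [C] can be moved inside the power and then under the integral. *)
have -> : C%:E = ((C `^ p)%:E `^ p^-1)%E.
  by rewrite poweR_EFin -powRrM mulfV ?gt_eqF// powRr1.
rewrite -poweRM ?lee_fin ?powR_ge0//; last first.
  by apply: integral_ge0 => x _; exact: poweR_ge0.
have pinv : 0 <= p^-1 by rewrite invr_ge0 ltW.
have i0 (h : 'rV[R]_n -> R) :
    (0 <= \int[lebesgue_rV n]_x `|(EFin \o h) x| `^ p)%E.
  by apply: integral_ge0 => x _; exact: poweR_ge0.
apply: (gt0_ler_poweR pinv).
- by rewrite in_itv/= leey andbT; exact: i0.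
- rewrite in_itv/= leey andbT; apply: mule_ge0; last exact: i0.
  by rewrite lee_fin powR_ge0.
rewrite -ge0_integralZl//; last 3 first.
- exact: mp.
- by move=> x _; exact: poweR_ge0.
- by rewrite lee_fin powR_ge0.
apply: ge0_le_integral => //.
- by move=> x _; exact: poweR_ge0.
- exact: mp.
- by apply: measurable_funeM; exact: mp.
- move=> x _ /=; rewrite lee_fin -powRM//.
  rewrite ge0_ler_powR// ?nnegrE ?mulr_ge0//; first exact: ltW.
  by rewrite [`|decay q x|]ger0_norm ?powR_ge0.
Qed.

Lemma Lfun_decay (g : 'rV[R]_n -> R) (p q C : R) : 1 <= p -> 0 <= C ->
  3 / 4 * n%:R <= q * p ->
  measurable_fun [set: 'rV[R]_n] g -> (forall x, `|g x| <= C * decay q x) ->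
  g \in Lfun (lebesgue_rV n) p%:E.
Proof.
move=> p1 C0 npq mg gC; rewrite inE; apply/andP; split; rewrite inE//=.
rewrite /finite_norm; apply: le_lt_trans (Lnorm_le_decay p1 C0 mg gC) _.
by rewrite lte_mul_pinfty// Lnorm_decay_lty.
Qed.

End sobolev.

(** * The profile and its derivatives *)

Section profile.
Context {R : realType} (n : nat).
Implicit Types (x v : 'rV[R]_n) (c eps : 'I_n -> R).

(** The restriction of [f] to the line through [x] along [v] reduces this to the chain rule in one
    real variable. *)
Lemma is_derive_powR_comp (f : 'rV[R]_n -> R) x v (df s : R) :
  0 < f x -> is_derive x v f df ->
  is_derive x v (fun y => f y `^ s) (s * f x `^ (s - 1) * df).
Proof.
move=> fx0 fd; pose g (h : R) := f (h *: v + x).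
have fg : forall h : R, f (h *: v + x) = g (h *: (1 : R) + 0).
  by move=> h; rewrite addr0 /g /GRing.scale/= mulr1.
have [dg eg] := derive_along fg.
have g0 : g 0 = f x by rewrite /g scale0r add0r.
have gd : is_derive (0 : R) (1 : R) g df.
  by split; [exact: dg|rewrite -eg derive_val].
have g0_gt0 : 0 < g 0 by rewrite g0.
have := is_derive1_comp (f := fun t => t `^ s) (is_derive1_powR s g0_gt0) gd.
rewrite g0 => pd.
have pg : forall h : R, g (h *: (1 : R) + 0) `^ s = f (h *: v + x) `^ s.
  by move=> h; rewrite -fg.
have [dp ep] := derive_along (f := (fun t => t `^ s) \o g)
  (g := fun y => f y `^ s) pg.
by split; [exact: dp|rewrite -ep derive_val].
Qed.

Lemma is_derive_coord x v i : is_derive x v (fun y : 'rV[R]_n => y 0 i) (v 0 i).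
Proof.
have fg : forall h : R, h *: (v 0 i) + x 0 i = (h *: v + x) 0 i.
  by move=> h; rewrite !mxE.
have [dp ep] := derive_along (V := R) (f := id) (g := fun y : 'rV[R]_n => y 0 i) fg.
by split; [exact: dp|rewrite -ep derive_val].
Qed.

Definition quad c x : R := \sum_i c i * x 0 i ^+ 2.

Lemma rho_quad x : rho x = quad (fun=> 1) x.
Proof. by apply: eq_bigr => i _; rewrite mul1r. Qed.

Lemma is_derive_quad c x j :
  is_derive x (delta_mx 0 j) (quad c) (2 * c j * x 0 j).
Proof.
have -> : quad c = \sum_i (fun y : 'rV[R]_n => c i * y 0 i ^+ 2).
  by apply/funext => y; rewrite fct_sumE.
have d i : is_derive x (delta_mx 0 j) (fun y : 'rV[R]_n => c i * y 0 i ^+ 2)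
    (if i == j then 2 * c j * x 0 j else 0).
  have /(@is_deriveZ _ _ _ _ (c i)) := is_deriveX 2 (is_derive_coord x (delta_mx 0 j) i).
  move=> /is_derive_eq; apply; rewrite mxE eqxx /= /GRing.scale/= expr1.
  by case: eqP => [->|_] /=; rewrite ?mulr1 ?mulr0// mulrCA mulrA.
apply: is_derive_eq; rewrite -big_mkcond big_pred1_eq//.
Qed.

(* The splitting of the coordinates is encoded by signs: [quad eps x] is
   [|x'|^2 - |x''|^2] for [eps i = 1] on the first half and [-1] on the second. *)
Variable eps : 'I_n -> R.
Hypotheses (eps2 : forall i, eps i ^+ 2 = 1) (eps_sum0 : \sum_i eps i = 0).
Variable a : R.

Definition den x : R := 1 + rho x ^+ 2 - 2 * a * quad eps x + a ^+ 2.

(** A quarter of the [i]-th partial derivative of [den]. *)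
Definition dfactor i x : R := (rho x - a * eps i) * x 0 i.

Lemma is_derive_rho x j : is_derive x (delta_mx 0 j) (@rho R n) (2 * x 0 j).
Proof.
rewrite (_ : @rho R n = quad (fun=> 1)); last by apply/funext => y; exact: rho_quad.
by have := is_derive_quad (fun=> 1) x j; rewrite mulr1.
Qed.

Lemma is_derive_den x j : is_derive x (delta_mx 0 j) den (4 * dfactor j x).
Proof.
have dr := is_deriveX 2 (is_derive_rho x j).
have dq := @is_deriveZ _ _ _ _ (- (2 * a)) _ _ _ (is_derive_quad eps x j).
have := is_deriveD (is_deriveD dr dq) (is_derive_cst (1 + a ^+ 2) x (delta_mx 0 j)).
rewrite (_ : _ + cst _ = den); last first.
  apply/funext => y.
  change (rho y ^+ 2 + - (2 * a) * quad eps y + (1 + a ^+ 2) = den y).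
  by rewrite /den; ring.
by move=> /is_derive_eq; apply; rewrite /GRing.scale /dfactor /=; ring.
Qed.

Lemma is_derive_dfactor x i j :
  is_derive x (delta_mx 0 j) (dfactor i)
    (2 * x 0 j * x 0 i + (i == j)%:R * (rho x - a * eps i)).
Proof.
have dr := is_deriveB (is_derive_rho x j) (is_derive_cst (a * eps i) x (delta_mx 0 j)).
have := is_deriveM dr (is_derive_coord x (delta_mx 0 j) i).
move=> /is_derive_eq; apply; rewrite mxE eqxx /= /GRing.scale/= !fctE/=; ring.
Qed.

Lemma quad_continuous c : continuous (quad c).
Proof.
apply: continuous_sum => i x.
apply: (@continuous_comp _ _ _ (fun x : 'rV[R]_n => x 0 i)
  (fun t => c i * t ^+ 2)); first exact: coord_continuous.
by apply: cvgM; [exact: cvg_cst|exact: exprn_continuous].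
Qed.

Lemma den_continuous : continuous den.
Proof.
have cr : continuous (fun x => 1 + a ^+ 2 + rho x ^+ 2).
  move=> x; apply: (@continuous_comp _ _ _ (@rho R n) (fun t => 1 + a ^+ 2 + t ^+ 2)).
    exact: rho_continuous.
  by apply: cvgD; [exact: cvg_cst|exact: exprn_continuous].
have cq : continuous (fun x => - (2 * a) * quad eps x).
  move=> x; apply: (@continuous_comp _ _ _ (quad eps) (fun t => - (2 * a) * t)).
    exact: quad_continuous.
  by apply: cvgM; [exact: cvg_cst|exact: cvg_id].
rewrite (_ : den = fun x => (1 + a ^+ 2 + rho x ^+ 2) + (- (2 * a) * quad eps x)).
  by move=> x; exact: (continuousD (cr x) (cq x)).
by apply/funext => x; rewrite /den; ring.
Qed.

Lemma dfactor_continuous i : continuous (dfactor i).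
Proof.
have cr : continuous (fun x => rho x - a * eps i).
  move=> x; apply: (@continuous_comp _ _ _ (@rho R n) (fun t => t - a * eps i)).
    exact: rho_continuous.
  by apply: cvgB; [exact: cvg_id|exact: cvg_cst].
by move=> x; exact: (continuousM (cr x) (@coord_continuous R 1 n 0 i x)).
Qed.

Lemma quad_eps_le_rho x : `|quad eps x| <= rho x.
Proof.
apply: le_trans (ler_norm_sum _ _ _) _; apply: ler_sum => i _.
rewrite normrM [X in _ * X]ger0_norm ?sqr_ge0//.
suff -> : `|eps i| = 1 by rewrite mul1r.
by apply/eqP; rewrite -sqrp_eq1// real_normK ?num_real// eps2.
Qed.

(** Since [a * quad eps x] is at most |a| rho, the square can be completed. *)
Lemma den_ge x : 1 + (rho x - `|a|) ^+ 2 <= den x.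
Proof.
have h : a * quad eps x <= `|a| * rho x.
  by rewrite (le_trans (ler_norm _))// normrM ler_wpM2l// quad_eps_le_rho.
rewrite /den -[a ^+ 2]real_normK ?num_real//; lra.
Qed.

Lemma den_ge1 x : 1 <= den x.
Proof. by apply: le_trans (den_ge x); rewrite lerDl sqr_ge0. Qed.

Lemma den_gt0 x : 0 < den x.
Proof. exact: lt_le_trans (den_ge1 x). Qed.

(* In view of [is_derive_den], [|grad den|^2 = 16 rho (den - 1)]. *)
Lemma sum_dfactor_sqr x : \sum_i dfactor i x ^+ 2 = rho x * (den x - 1).
Proof.
rewrite (eq_bigr (fun i => (rho x ^+ 2 + a ^+ 2) * x 0 i ^+ 2
                       + - (2 * a * rho x) * (eps i * x 0 i ^+ 2))); last first.
  move=> i _; rewrite /dfactor exprMn sqrrB exprMn eps2; ring.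
rewrite big_split/= -!mulr_sumr -/(rho x) -/(quad eps x) /den; ring.
Qed.

Variable m : R.

Definition prof x : R := den x `^ (- m).

Definition dprof i x : R := - (4 * m) * (den x `^ (- m - 1) * dfactor i x).

Lemma is_derive_prof x i : is_derive x (delta_mx 0 i) prof (dprof i x).
Proof.
have := is_derive_powR_comp (- m) (den_gt0 x) (is_derive_den x i).
by move=> /is_derive_eq; apply; rewrite /dprof; ring.
Qed.

Lemma partial_prof i : partial i prof = dprof i.
Proof. by apply/funext => x; have [_] := is_derive_prof x i. Qed.

Definition ddprof i j x : R :=
  16 * m * (m + 1) * (den x `^ (- m - 2) * (dfactor i x * dfactor j x))
  - 4 * m * (den x `^ (- m - 1) *
     (2 * x 0 j * x 0 i + (i == j)%:R * (rho x - a * eps i))).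

Lemma is_derive_dprof x i j :
  is_derive x (delta_mx 0 j) (dprof i) (ddprof i j x).
Proof.
have d1 := is_derive_powR_comp (- m - 1) (den_gt0 x) (is_derive_den x j).
have := @is_deriveZ _ _ _ _ (- (4 * m)) _ _ _ (is_deriveM d1 (is_derive_dfactor x i j)).
move=> /is_derive_eq; apply; rewrite /ddprof /GRing.scale/=.
rewrite (_ : - m - 1 - 1 = - m - 2); last by ring.
ring.
Qed.

Lemma partial_dprof i j : partial j (dprof i) = ddprof i j.
Proof. by apply/funext => x; have [_] := is_derive_dprof x i j. Qed.

Lemma den_powR_continuous s : continuous (fun x => den x `^ s).
Proof. by apply: continuous_powR_comp; [exact: den_continuous|exact: den_gt0]. Qed.

Lemma continuousZ_fun k (f : 'rV[R]_n -> R) : continuous f -> continuous (fun x => k * f x).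
Proof.
move=> cf x; apply: (@continuous_comp _ _ _ f (fun t => k * t)); first exact: cf.
by apply: cvgM; [exact: cvg_cst|exact: cvg_id].
Qed.

Lemma dprof_continuous i : continuous (dprof i).
Proof.
apply: continuousZ_fun => x.
exact: (continuousM (@den_powR_continuous _ x) (@dfactor_continuous i x)).
Qed.

Lemma ddprof_continuous i j : continuous (ddprof i j).
Proof.
have c1 : continuous (fun x => den x `^ (- m - 2) * (dfactor i x * dfactor j x)).
  move=> x; exact: (continuousM (@den_powR_continuous _ x)
    (continuousM (@dfactor_continuous i x) (@dfactor_continuous j x))).
have c2 : continuous (fun x : 'rV[R]_n => 2 * (x 0 j * x 0 i)).
  apply: continuousZ_fun => x.
  exact: (continuousM (@coord_continuous R 1 n 0 j x) (@coord_continuous R 1 n 0 i x)).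
have c3 : continuous (fun x => (i == j)%:R * (rho x - a * eps i)).
  apply: continuousZ_fun => x.
  apply: (@continuous_comp _ _ _ (@rho R n) (fun t => t - a * eps i)).
    exact: rho_continuous.
  by apply: cvgB; [exact: cvg_id|exact: cvg_cst].
have c4 : continuous (fun x => den x `^ (- m - 1) *
    (2 * (x 0 j * x 0 i) + (i == j)%:R * (rho x - a * eps i))).
  by move=> x; exact: (continuousM (@den_powR_continuous _ x) (continuousD (c2 x) (c3 x))).
have -> : ddprof i j = fun x => 16 * m * (m + 1) *
     (den x `^ (- m - 2) * (dfactor i x * dfactor j x))
   + - (4 * m) * (den x `^ (- m - 1) *
    (2 * (x 0 j * x 0 i) + (i == j)%:R * (rho x - a * eps i))).
  by apply/funext => x; rewrite /ddprof; ring.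
have cz1 := continuousZ_fun (k := 16 * m * (m + 1)) c1.
have cz4 := continuousZ_fun (k := - (4 * m)) c4.
by move=> x; exact: (continuousD (cz1 x) (cz4 x)).
Qed.

Lemma prof_Ck2 : Ck 2 prof.
Proof.
split; first exact: den_powR_continuous.
move=> i; split; first by move=> x; have [] := is_derive_prof x i.
rewrite partial_prof; split; first exact: dprof_continuous.
move=> j; split; first by move=> x; have [] := is_derive_dprof x i j.
by rewrite partial_dprof; split => //; exact: ddprof_continuous.
Qed.

(** With 4m = N - 2 the coefficients 16 m (m + 1) and 4 m (N + 2) are both (N - 2)(N + 2). So the
    Laplacian is this number times rho den^(-m - 2) ((den - 1) - den), and the last factor is -1.
    The terms linear in [a] cancel by [eps_sum0]. *)
Lemma prof_laplacian x : m = (n%:R - 2) / 4 ->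
  - laplacian prof x = (n%:R + 2) * (n%:R - 2) * rho x * den x `^ (- m - 2).
Proof.
move=> mE; rewrite /laplacian.
under eq_bigr do rewrite partial_prof partial_dprof /ddprof eqxx.
set p := den x `^ (- m - 2).
(* Both terms of the second derivatives get the common factor [p]. *)
have -> : den x `^ (- m - 1) = den x * p.
  rewrite /p (_ : - m - 1 = 1 + (- m - 2)); last by ring.
  rewrite powRD; last by apply/implyP => _; rewrite gt_eqF// den_gt0.
  by rewrite powRr1// ltW// den_gt0.
rewrite (eq_bigr (fun i => 16 * m * (m + 1) * p * dfactor i x ^+ 2
   + - (4 * m * (den x * p)) * (2 * x 0 i ^+ 2 + (rho x + - a * eps i)))); last first.
  by move=> i _ /=; ring.
rewrite big_split/= -!mulr_sumr sum_dfactor_sqr big_split/= -mulr_sumr -/(rho x).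
rewrite big_split/= -mulr_sumr eps_sum0 sumr_const card_ord -mulr_natr mE.
by field.
Qed.

End profile.

(** * Decay estimates, locally uniform in the parameter *)

Section estimates.
Context {R : realType}.

Lemma decayD n q r (x : 'rV[R]_n) : decay (q + r) x = decay q x * decay r x.
Proof.
by rewrite /decay opprD powRD//; apply/implyP => _; rewrite gt_eqF// rho_gt0.
Qed.

Lemma ler_decay n q r (x : 'rV[R]_n) : q <= r -> decay r x <= decay q x.
Proof. by move=> qr; rewrite /decay ler_powR ?rho_ge1// lerN2. Qed.

Lemma coord_le_decay n (x : 'rV[R]_n) i : `|x 0 i| <= decay (- 2^-1) x.
Proof.
rewrite /decay opprK powR12_sqrt; last exact/ltW/rho_gt0.
by apply: le_trans (coord_le_enorm x i) _; rewrite ler_wsqrtr// lerDr.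
Qed.

Lemma decayN1 n (x : 'rV[R]_n) : decay (- 1) x = 1 + rho x.
Proof. by rewrite /decay opprK powRr1//; exact/ltW/rho_gt0. Qed.

(** Mean value theorem: on the half-line from [l] the derivative is largest in absolute value at
    [l]. *)
Lemma powRN_lipschitz (l s x y : R) : 0 < l -> 0 <= s -> l <= x -> l <= y ->
  `|x `^ (- s) - y `^ (- s)| <= s * l `^ (- s - 1) * `|x - y|.
Proof.
move=> l0 s0; wlog xy : x y / x <= y.
  move=> H lx ly; have [xy|/ltW yx] := leP x y; first exact: H.
  by rewrite distrC [X in _ * X]distrC; exact: H.
move=> lx ly.
have d t : l <= t -> is_derive t 1 (fun t => t `^ (- s)) (- s * t `^ (- s - 1)).
  by move=> lt; apply: is_derive1_powR; exact: lt_le_trans lt.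
have [t||c] := MVT_segment (f := fun t => t `^ (- s))
  (df := fun t => - s * t `^ (- s - 1)) xy.
- by rewrite in_itv/= => /andP[xt _]; apply: d; exact: le_trans (ltW xt).
- apply: continuous_in_subspaceT => t; rewrite inE /= in_itv/= => /andP[xt _].
  by apply: powR_continuous_at; apply: lt_le_trans l0 _; exact: le_trans xt.
rewrite in_itv/= => /andP[xc _] e.
rewrite distrC e [`|x - y|]distrC normrM normrM normrN (ger0_norm s0).
rewrite (ger0_norm (powR_ge0 _ _)) ler_wpM2r// ler_wpM2l//.
by rewrite -opprD; apply: ge0_ler_powRN => //; [lra|exact: le_trans xc].
Qed.

Section bounds.
Variables (n : nat) (eps : 'I_n -> R) (A : R).
Hypotheses (eps2 : forall i, eps i ^+ 2 = 1) (A0 : 0 <= A).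

Let K : R := 4 * (1 + A ^+ 2).

Let K0 : 0 < K.
Proof. by rewrite mulr_gt0// ltr_wpDr// sqr_ge0. Qed.

Let normr_eps i : `|eps i| = 1.
Proof. by apply/eqP; rewrite -sqrp_eq1// real_normK ?num_real// eps2. Qed.

(** With b = |a| <= A, (1 + rho)^2 <= 2 + 2 rho^2 and rho^2 <= 2 (rho - b)^2 + 2 b^2. Together they
    give the constant [K]. *)
Lemma sqr_rho_le_den a (x : 'rV[R]_n) : `|a| <= A ->
  (1 + rho x) ^+ 2 / K <= den eps a x.
Proof.
move=> aA; rewrite ler_pdivrMr//.
have h : 1 + (rho x - `|a|) ^+ 2 <= den eps a x by exact: den_ge.
apply: (@le_trans _ _ ((1 + (rho x - `|a|) ^+ 2) * K)); last first.
  by rewrite ler_wpM2r// ltW.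
rewrite /K; have b0 := normr_ge0 a; set b := `|a| in aA h b0 *.
have b2 : b ^+ 2 <= A ^+ 2 by rewrite ler_sqr ?nnegrE.
have s1 := sqr_ge0 (1 - rho x); have s2 := sqr_ge0 (rho x - 2 * b).
have s3 : 0 <= (rho x - b) ^+ 2 * A ^+ 2 by rewrite mulr_ge0 ?sqr_ge0.
have := sqr_ge0 A; nra.
Qed.

(** A lower bound of [den] common to all parameters with |a| <= A, used as the [l] of
    [powRN_lipschitz]. *)
Let l (x : 'rV[R]_n) := (1 + rho x) ^+ 2 / K.

Let l_gt0 x : 0 < l x.
Proof. by rewrite /l divr_gt0// exprn_gt0// rho_gt0. Qed.

Let l_powR s x : l x `^ (- s) = K `^ s * decay (2 * s) x.
Proof.
rewrite /l powRM; [|exact/exprn_ge0/ltW/rho_gt0|by rewrite invr_ge0 ltW].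
rewrite -powR_mulrn; last exact/ltW/rho_gt0.
rewrite -powR_inv1; last exact: ltW.
by rewrite -!powRrM mulrC mulN1r opprK /decay mulrN.
Qed.

Lemma den_powR_le a s (x : 'rV[R]_n) : `|a| <= A -> 0 <= s ->
  den eps a x `^ (- s) <= K `^ s * decay (2 * s) x.
Proof.
by move=> aA s0; rewrite -l_powR; apply: ge0_ler_powRN => //; exact: sqr_rho_le_den.
Qed.

(** The difference factors as (a - b)(a + b - 2 [quad eps x]), whose second factor grows at most
    like 1 + rho. *)
Lemma den_sub_le a b (x : 'rV[R]_n) : `|a| <= A -> `|b| <= A ->
  `|den eps a x - den eps b x| <= 2 * (1 + A) * `|a - b| * decay (- 1) x.
Proof.
move=> aA bA; rewrite decayN1.
have -> : den eps a x - den eps b x = (a - b) * (a + b - 2 * quad eps x).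
  by rewrite /den; ring.
rewrite normrM -mulrA mulrCA ler_wpM2l//.
have q := quad_eps_le_rho eps2 x.
have s1 : `|a + b - 2 * quad eps x| <= `|a| + `|b| + 2 * `|quad eps x|.
  rewrite (le_trans (ler_normB _ _))// lerD ?ler_normD//.
  by rewrite normrM ger0_norm.
have rA : 0 <= A * rho x by rewrite mulr_ge0// rho_ge0.
nra.
Qed.

(** The Lipschitz constant decays with exponent 2 (s + 1), and the increment of [den] costs 1. *)
Lemma den_powR_sub_le a b s (x : 'rV[R]_n) : `|a| <= A -> `|b| <= A -> 0 <= s ->
  `|den eps a x `^ (- s) - den eps b x `^ (- s)| <=
  s * K `^ (s + 1) * (2 * (1 + A)) * `|a - b| * decay (2 * s + 1) x.
Proof.
move=> aA bA s0.
apply: le_trans (powRN_lipschitz (l_gt0 x) s0 (sqr_rho_le_den x aA) (sqr_rho_le_den x bA)) _.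
rewrite -opprD l_powR.
rewrite (_ : decay (2 * s + 1) x = decay (2 * (s + 1)) x * decay (- 1) x); last first.
  by rewrite -decayD; congr (decay _ x); ring.
rewrite -!mulrA ler_wpM2l// ler_wpM2l ?powR_ge0//.
rewrite [leRHS](_ : _ = decay (2 * (s + 1)) x * (2 * (1 + A) * `|a - b| * decay (-1) x)).
  by rewrite ler_wpM2l ?den_sub_le// ltW// decay_gt0.
by ring.
Qed.

(** Cubic growth: exponent 1 from the factor in rho and 1/2 from the coordinate. *)
Lemma dfactor_le a i (x : 'rV[R]_n) : `|a| <= A ->
  `|dfactor eps a i x| <= (1 + A) * decay (- (3 / 2)) x.
Proof.
move=> aA; rewrite /dfactor normrM.
rewrite (_ : decay (- (3 / 2)) x = decay (- 1) x * decay (- 2^-1) x); last first.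
  by rewrite -decayD; congr (decay _ x); field.
rewrite mulrA ler_pM// ?coord_le_decay// decayN1.
apply: le_trans (ler_normB _ _) _.
rewrite normrM normr_eps mulr1 [`|rho x|]ger0_norm ?rho_ge0//.
have rA : 0 <= A * rho x by rewrite mulr_ge0// rho_ge0.
nra.
Qed.

Lemma dfactor_sub a b i (x : 'rV[R]_n) :
  `|dfactor eps a i x - dfactor eps b i x| <= `|a - b| * decay (- 2^-1) x.
Proof.
have -> : dfactor eps a i x - dfactor eps b i x = - (a - b) * eps i * x 0 i.
  by rewrite /dfactor; ring.
by rewrite !normrM normrN normr_eps mulr1 ler_wpM2l// coord_le_decay.
Qed.

Variable m : R.
Hypothesis m0 : 0 <= m.

Lemma prof_decay : exists2 C, 0 <= C &
  forall a (x : 'rV[R]_n), `|a| <= A -> `|prof eps a m x| <= C * decay (2 * m) x.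
Proof.
exists (K `^ m); first exact: powR_ge0.
by move=> a x aA; rewrite ger0_norm ?powR_ge0// den_powR_le.
Qed.

(** The exponent is 2 (m + 1) from the power of [den], less 3/2 from [dfactor]. *)
Lemma dprof_decay : exists2 C, 0 <= C &
  forall a i (x : 'rV[R]_n), `|a| <= A ->
  `|dprof eps a m i x| <= C * decay (2 * m + 2^-1) x.
Proof.
exists (4 * m * (K `^ (m + 1) * (1 + A))).
  by rewrite !mulr_ge0 ?powR_ge0 ?addr_ge0.
move=> a i x aA; rewrite /dprof normrM normrN [`|4 * m|]ger0_norm ?mulr_ge0//.
rewrite -[leRHS]mulrA ler_wpM2l ?mulr_ge0// normrM [`|_ `^ _|]ger0_norm ?powR_ge0//.
rewrite (_ : decay (2 * m + 2^-1) x = decay (2 * (m + 1)) x * decay (- (3 / 2)) x); last first.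
  by rewrite -decayD; congr (decay _ x); field.
rewrite mulrACA ler_pM ?powR_ge0 ?dfactor_le//.
by rewrite -opprD den_powR_le// addr_ge0.
Qed.

Lemma prof_sub_decay : exists2 C, 0 <= C &
  forall a b (x : 'rV[R]_n), `|a| <= A -> `|b| <= A ->
  `|prof eps a m x - prof eps b m x| <= C * `|a - b| * decay (2 * m) x.
Proof.
exists (m * K `^ (m + 1) * (2 * (1 + A))).
  by rewrite !mulr_ge0 ?powR_ge0 ?addr_ge0.
move=> a b x aA bA; apply: le_trans (den_powR_sub_le x aA bA m0) _.
by rewrite ler_wpM2l ?ler_decay ?lerDl// !mulr_ge0 ?powR_ge0 ?addr_ge0.
Qed.

Lemma dprof_sub_decay : exists2 C, 0 <= C &
  forall a b i (x : 'rV[R]_n), `|a| <= A -> `|b| <= A ->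
  `|dprof eps a m i x - dprof eps b m i x| <= C * `|a - b| * decay (2 * m + 2^-1) x.
Proof.
have m1 : 0 <= m + 1 by rewrite addr_ge0.
pose C1 := (m + 1) * K `^ (m + 1 + 1) * (2 * (1 + A)).
have C10 : 0 <= C1 by rewrite !mulr_ge0 ?powR_ge0 ?addr_ge0.
exists (4 * m * (C1 * (1 + A) + K `^ (m + 1))).
  by rewrite !mulr_ge0// addr_ge0 ?powR_ge0// mulr_ge0// addr_ge0.
move=> a b i x aA bA; rewrite /dprof -opprD.
set Pa := den eps a x `^ _; set Pb := den eps b x `^ _.
set fa := dfactor eps a i x; set fb := dfactor eps b i x.
(* Increment of a product. Both summands decay with exponent 2m + 3/2, which is then weakened to 2m
   + 1/2. *)
have -> : - (4 * m) * (Pa * fa) - - (4 * m) * (Pb * fb) =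
          - (4 * m) * ((Pa - Pb) * fa + Pb * (fa - fb)) by ring.
pose E := `|a - b| * decay (2 * m + 2^-1) x.
have -> : 4 * m * (C1 * (1 + A) + K `^ (m + 1)) * `|a - b| * decay (2 * m + 2^-1) x
    = 4 * m * (C1 * (1 + A) * E + K `^ (m + 1) * E) by rewrite /E; ring.
rewrite normrM normrN [`|4 * m|]ger0_norm ?mulr_ge0// ler_wpM2l ?mulr_ge0//.
apply: le_trans (ler_normD _ _) _; rewrite (normrM (Pa - Pb)) (normrM Pb).
have CA : 0 <= C1 * (1 + A) by rewrite mulr_ge0// addr_ge0.
have h1 : `|Pa - Pb| * `|fa| <= C1 * (1 + A) * (`|a - b| * decay (2 * m + 2^-1) x).
  have := ler_pM (normr_ge0 _) (normr_ge0 _) (den_powR_sub_le x aA bA m1) (dfactor_le i x aA).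
  move=> /le_trans; apply.
  apply: (@le_trans _ _ (C1 * (1 + A) * (`|a - b| * decay (2 * m + 3 / 2) x))).
    rewrite (_ : decay (2 * m + 3 / 2) x = decay (2 * (m + 1) + 1) x * decay (- (3 / 2)) x).
      by rewrite /C1 le_eqVlt; apply/orP; left; apply/eqP; ring.
    by rewrite -decayD; congr (decay _ x); field.
  by rewrite ler_wpM2l// ler_wpM2l// ler_decay//; lra.
have h2 : `|Pb| * `|fa - fb| <= K `^ (m + 1) * (`|a - b| * decay (2 * m + 2^-1) x).
  have bP : `|Pb| <= K `^ (m + 1) * decay (2 * (m + 1)) x.
    by rewrite ger0_norm ?powR_ge0// den_powR_le.
  have := ler_pM (normr_ge0 _) (normr_ge0 _) bP (dfactor_sub a b i x).
  move=> /le_trans; apply.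
  apply: (@le_trans _ _ (K `^ (m + 1) * (`|a - b| * decay (2 * m + 3 / 2) x))).
    rewrite (_ : decay (2 * m + 3 / 2) x = decay (2 * (m + 1)) x * decay (- 2^-1) x).
      by rewrite le_eqVlt; apply/orP; left; apply/eqP; ring.
    by rewrite -decayD; congr (decay _ x); field.
  by rewrite ler_wpM2l ?powR_ge0// ler_wpM2l// ler_decay//; lra.
exact: lerD.
Qed.

End bounds.

End estimates.

(** * The branch *)

Section sobolev_criteria.
Context {R : realType} (n : nat).
Implicit Types u v : 'rV[R]_n -> R.

Lemma gradient_continuous u : Ck 1 u ->
  continuous (fun x => enorm (\row_i partial i u x)).
Proof.
move=> [_ du] x; have c : continuous (fun x => \sum_i partial i u x ^+ 2).
  apply: continuous_sum => i y; have [_ [ci _]] := du i.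
  apply: (@continuous_comp _ _ _ (partial i u) (fun t => t ^+ 2)); first exact: ci.
  exact: exprn_continuous.
rewrite (_ : (fun x => _) = Num.sqrt \o fun x => \sum_i partial i u x ^+ 2).
  by apply: continuous_comp; [exact: c|exact: sqrt_continuous].
by apply/funext => y; congr Num.sqrt; apply: eq_bigr => i _; rewrite mxE.
Qed.

Lemma Ck1_sub u v : Ck 1 u -> Ck 1 v ->
  Ck 1 (u \- v) /\ forall i, partial i (u \- v) = partial i u \- partial i v.
Proof.
move=> [cu du] [cv dv].
have d i x : is_derive x (delta_mx 0 i) (u \- v) (partial i u x - partial i v x).
  by apply: is_deriveB; apply: derivableP; [apply: (du i).1|apply: (dv i).1].
have p i : partial i (u \- v) = partial i u \- partial i v.
  by apply/funext => x; have [_] := d i x.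
split=> //; split; first by move=> x; exact: (continuousB (cu x) (cv x)).
move=> i; split; first by move=> x; have [] := d i x.
have [_ [cui _]] := du i; have [_ [cvi _]] := dv i.
by rewrite p; split=> // x; exact: (continuousB (cui x) (cvi x)).
Qed.

Lemma enorm_gradient_decay u (C q : R) x :
  (forall i, `|partial i u x| <= C * decay q x) ->
  `|enorm (\row_i partial i u x)| <= n%:R * C * decay q x.
Proof.
move=> h; rewrite ger0_norm ?sqrtr_ge0//; apply: le_trans (enorm_le_sum _) _.
rewrite -mulrA mulr_natl -[X in _ *+ X]card_ord -sumr_const.
by apply: ler_sum => i _; rewrite mxE.
Qed.

Lemma D12_decay u (p C q r : R) : 1 <= p -> p = 2 * n%:R / (n%:R - 2) -> 0 <= C ->
  3 / 4 * n%:R <= q * p -> 3 / 4 * n%:R <= r * 2 -> Ck 1 u ->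
  (forall x, `|u x| <= C * decay q x) ->
  (forall i x, `|partial i u x| <= C * decay r x) -> D12 u.
Proof.
move=> p1 pE C0 qp r2 c1u uC duC; split.
  rewrite -pE; apply: (Lfun_decay p1 C0 qp) => //.
  by apply: measurable_continuous_rV; case: c1u.
exists (fun x => \row_i partial i u x); first exact: weak_gradient_Ck1.
apply: (@Lfun_decay _ _ _ 2 r (n%:R * C)) => //.
- by rewrite ler1n.
- by rewrite mulr_ge0.
- exact: measurable_continuous_rV (gradient_continuous c1u).
- by move=> x; apply: enorm_gradient_decay.
Qed.

(** From (1 + |x|)^2 <= 2 (1 + rho), the weight is at most 2^(beta/2) (1 + rho)^(beta/2), which
    [decay q] compensates as beta/2 <= q. *)
Lemma beta_norm_le_decay u (beta C q : R) : 0 <= beta -> beta <= 2 * q -> 0 <= C ->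
  (forall x, `|u x| <= C * decay q x) ->
  (beta_norm beta u <= (2 `^ (beta / 2) * C)%:E)%E.
Proof.
move=> b0 bq C0 uC; apply: ge_ereal_sup => _ [x _ <-]; rewrite lee_fin.
have h : (1 + enorm x) `^ beta <= 2 `^ (beta / 2) * decay (- (beta / 2)) x.
  have e0 : 0 <= enorm x by exact: sqrtr_ge0.
  rewrite /decay opprK -powRM//; last exact/ltW/rho_gt0.
  rewrite [leLHS](_ : _ = ((1 + enorm x) ^+ 2) `^ (beta / 2)); last first.
    by rewrite -powR_mulrn ?addr_ge0// -powRrM; congr (_ `^ _); field.
  have r0 := rho_gt0 x.
  apply: ge0_ler_powR.
  - by rewrite divr_ge0.
  - by rewrite nnegrE exprn_ge0// addr_ge0.
  - by rewrite nnegrE mulr_ge0// ltW.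
  - by have := sqr_ge0 (1 - enorm x); have := enorm_sqr x; nra.
apply: le_trans (ler_pM (powR_ge0 _ _) (normr_ge0 _) h (uC x)) _.
rewrite mulrACA -decayD -[leRHS]mulr1 ler_wpM2l ?mulr_ge0 ?powR_ge0//.
rewrite [leRHS](_ : 1 = decay 0 x); last by rewrite /decay oppr0 powRr0.
by apply: ler_decay; lra.
Qed.

Lemma spaceX_decay u (beta C q : R) : 0 <= beta -> beta <= 2 * q -> 0 <= C ->
  continuous u -> (forall x, `|u x| <= C * decay q x) -> D12 u -> spaceX beta u.
Proof.
move=> b0 bq C0 cu uC du; split => //; last first.
  by apply: le_lt_trans (beta_norm_le_decay b0 bq C0 uC) _; exact: ltry.
rewrite inE; apply/andP; split; rewrite inE/=; first exact: measurable_continuous_rV.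
(* By definition the norm is an essential supremum in one case and a finite constant in the
   other. *)
rewrite /finite_norm unlock /Lnorm; case: ifP => _; last exact: ltry.
apply: (@le_lt_trans _ _ C%:E); last exact: ltry.
apply: (@ess_sup_ler _ _ _ _ (fun x => `|u x|)) => x; rewrite lee_fin.
apply: le_trans (uC x) _; rewrite -[leRHS]mulr1 ler_wpM2l//.
rewrite [leRHS](_ : 1 = decay 0 x); last by rewrite /decay oppr0 powRr0.
by apply: ler_decay; lra.
Qed.

Lemma normX_sub_le u v (beta C q r : R) : 0 <= beta -> beta <= 2 * q -> 0 <= C ->
  3 / 4 * n%:R <= r * 2 -> Ck 1 u -> Ck 1 v ->
  (forall x, `|u x - v x| <= C * decay q x) ->
  (forall i x, `|partial i u x - partial i v x| <= C * decay r x) ->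
  (normX beta (u \- v)%R <= (C * (2 `^ (beta / 2) +
     n%:R * fine 'N[lebesgue_rV n]_2%:E[EFin \o decay r]%E))%:E)%E.
Proof.
move=> b0 bq C0 r2 cu cv uvC duvC.
have [cw pw] := Ck1_sub cu cv.
have two1 : 1 <= 2 :> R by rewrite ler1n.
have Nfin := Lnorm_decay_lty two1 r2.
set L := ('N[lebesgue_rV n]_2%:E[EFin \o decay r])%E in Nfin *.
have L0 : (0 <= L)%E by exact: Lnorm_ge0.
have fL : 0 <= fine L by rewrite fine_ge0.
rewrite /normX ge_max; apply/andP; split.
  (* The classical gradient of [u \- v] is one competitor in the infimum. *)
  apply: ge_ereal_inf.
  exists ('N[lebesgue_rV n]_2%:E
     [EFin \o (enorm \o (fun x => \row_i partial i (u \- v)%R x))])%E.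
    by exists (fun x => \row_i partial i (u \- v) x) => //; exact: weak_gradient_Ck1.
  have NC : 0 <= n%:R * C by rewrite mulr_ge0.
  have mg := measurable_continuous_rV (gradient_continuous cw).
  apply: (le_trans (@Lnorm_le_decay _ _ _ 2 r _ two1 NC mg _)).
    by move=> x; apply: enorm_gradient_decay => i; rewrite pw; exact: duvC.
  rewrite -/L -[L]fineK ?ge0_fin_numE// -EFinM lee_fin.
  by rewrite /= mulrDr mulrA (mulrC n%:R) -[leLHS]add0r lerD2r mulr_ge0// powR_ge0.
apply: le_trans (beta_norm_le_decay b0 bq C0 uvC) _.
by rewrite lee_fin mulrDr [C * _]mulrC lerDl mulr_ge0// mulr_ge0.
Qed.

Lemma normX_ge0 (beta : R) u : (0 <= normX beta u)%E.
Proof.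
rewrite /normX le_max; apply/orP; right.
apply: le_trans (ereal_sup_ubound _); last by exists 0; [|reflexivity].
by rewrite lee_fin mulr_ge0// powR_ge0.
Qed.

End sobolev_criteria.

(** * The splitting of the coordinates into two halves *)

Section halves.
Context {R : realType} (n : nat).
Hypothesis n_even : ~~ odd n.

Lemma sum_halves (F : 'I_n -> R) : \sum_i F i =
  \sum_(j < n./2) F (widen_ord (@fst_half_subproof n) j) +
  \sum_(j < n./2) F (Ordinal (snd_half_subproof j)).
Proof.
(* The half and the two bounds are generalized so that [n] can be replaced by [h + h]. *)
move: (@fst_half_subproof n) (@snd_half_subproof n) => le1 lt2.
have : n = (n./2 + n./2)%N by rewrite addnn -{1}(odd_double_half n) (negbTE n_even).
move: (n./2) le1 lt2 F => h le1 lt2 F e; subst n; rewrite big_split_ord/=.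
by congr (_ + _); apply: eq_bigr => j _; congr F; exact/val_inj.
Qed.

Definition half_sign (i : 'I_n) : R := if (i < n./2)%N then 1 else -1.

Lemma half_sign_sqr i : half_sign i ^+ 2 = 1.
Proof. by rewrite /half_sign; case: ifP; rewrite ?sqrrN expr1n. Qed.

Lemma half_sign_fst j : half_sign (widen_ord (@fst_half_subproof n) j) = 1.
Proof. by rewrite /half_sign/= ltn_ord. Qed.

Lemma half_sign_snd j : half_sign (Ordinal (snd_half_subproof j)) = -1.
Proof. by rewrite /half_sign/= ltnNge leq_addr. Qed.

(** The halves have equal dimension; this makes |x'|^2 - |x''|^2 harmonic. *)
Lemma sum_half_sign : \sum_i half_sign i = 0.
Proof.
rewrite sum_halves (eq_bigr _ (fun j _ => half_sign_fst j)).
rewrite [X in _ + X](eq_bigr _ (fun j _ => half_sign_snd j)).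
by rewrite sumrN subrr.
Qed.

Lemma quad_half_sign (x : 'rV[R]_n) :
  quad half_sign x = enorm (fst_half x) ^+ 2 - enorm (snd_half x) ^+ 2.
Proof.
rewrite !enorm_sqr /quad sum_halves /rho; congr (_ + _).
  by apply: eq_bigr => j _; rewrite half_sign_fst mul1r mxE.
by rewrite -sumrN; apply: eq_bigr => j _; rewrite half_sign_snd mulN1r mxE.
Qed.

Lemma u_branchE a : @u_branch R n a = prof half_sign a ((n%:R - 2) / 4).
Proof.
apply/funext => x; rewrite /u_branch /prof /den powRN div1r; congr (_ `^ _)^-1.
by rewrite quad_half_sign -enorm_sqr -exprM.
Qed.

End halves.

(** * Solutions, continuity and symmetry breaking along the branch *)

Section branch.
Context {R : realType} (N : nat).
Hypothesis N4 : (4 : R) <= N%:R.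
Notation eps := (@half_sign R N).
Notation m := ((N%:R - 2) / 4).

Let m0 : (0 : R) <= m.
Proof. by have h := N4; lra. Qed.

Lemma prof_Ck1 a : Ck 1 (prof eps a m).
Proof.
have [c d] := prof_Ck2 (@half_sign_sqr R N) a m.
by split=> // i; have [di [ci _]] := d i.
Qed.

(** The powers to be integrated have exponent N for the function and 2 (2m + 1/2) = N - 1 for the
    gradient. Both are at least 3N/4 since N >= 4. *)
Lemma D12_prof a : D12 (prof eps a m).
Proof.
have N4' := N4.
have [C C0 uC] := prof_decay (@half_sign_sqr R N) (normr_ge0 a) m0.
have [C' C'0 duC] := dprof_decay (@half_sign_sqr R N) (normr_ge0 a) m0.
have N2 : 0 < N%:R - 2 :> R by lra.
have pq : 2 * m * (2 * N%:R / (N%:R - 2)) = N%:R :> R by field; rewrite gt_eqF.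
apply: (@D12_decay _ _ _ (2 * N%:R / (N%:R - 2)) (C + C') (2 * m) (2 * m + 2^-1)) => //.
- by rewrite ler_pdivlMr// mul1r; lra.
- exact: addr_ge0.
- by rewrite pq; lra.
- lra.
- exact: prof_Ck1.
- move=> x; apply: le_trans (uC a x (lexx _)) _.
  by rewrite ler_wpM2r ?lerDl// ltW// decay_gt0.
- move=> i x; rewrite partial_prof; last exact: half_sign_sqr.
  apply: le_trans (duC a i x (lexx _)) _.
  by rewrite ler_wpM2r ?lerDr// ltW// decay_gt0.
Qed.

Lemma solution_prof a : ~~ odd N -> solution (prof eps a m).
Proof.
have N4' := N4.
have N2 : N%:R - 2 != 0 :> R by rewrite gt_eqF//; lra.
move=> N_even.
split; first exact: prof_Ck2 (@half_sign_sqr R N) a m.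
- move=> x; rewrite (prof_laplacian (@half_sign_sqr R N) (sum_half_sign N_even))//.
  (* The exponents agree: m (N + 6)/(N - 2) = (N + 6)/4 = m + 2. *)
  rewrite enorm_sqr /prof -powRrM; congr (_ * _ `^ _).
  by field.
- by move=> x; rewrite powR_gt0// den_gt0//; exact: half_sign_sqr.
- exact: D12_prof.
Qed.

Variable beta : R.
Hypotheses (b0 : 0 <= beta) (bN : beta <= N%:R - 2).

Let b4m : beta <= 2 * (2 * m).
Proof. by have h := bN; lra. Qed.

Lemma spaceX_prof a : spaceX beta (prof eps a m).
Proof.
have [C C0 uC] := prof_decay (@half_sign_sqr R N) (normr_ge0 a) m0.
apply: (spaceX_decay b0 b4m C0) => //.
- by have [] := prof_Ck1 a.
- by move=> x; exact: uC.
- exact: D12_prof.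
Qed.

(** For |a - a0| < 1 the decay estimates hold with the fixed bound A = |a0| + 1, so the norm is
    squeezed between 0 and |a - a0| times a constant independent of [a]. *)
Lemma prof_cvg a0 :
  normX beta (prof eps a m \- prof eps a0 m) @[a --> a0] --> 0%E.
Proof.
have N4' := N4.
have A0 : 0 <= `|a0| + 1 by rewrite addr_ge0.
have [C C0 uC] := prof_sub_decay (@half_sign_sqr R N) A0 m0.
have [C' C'0 duC] := dprof_sub_decay (@half_sign_sqr R N) A0 m0.
pose r : R := 2 * m + 2^-1.
pose M := (C + C') * (2 `^ (beta / 2) +
     N%:R * fine 'N[lebesgue_rV N]_2%:E[EFin \o decay r]%E).
apply: (@squeeze_cvge _ _ _ _ (cst 0%E) _ (fun a => (`|a - a0| * M)%:E)).
- near=> a; rewrite normX_ge0/=.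
  have a1 : `|a - a0| < 1.
    near: a; have := @nbhsx_ballx R R a0 1 ltr01.
    by apply: filterS => a; rewrite /ball/= distrC.
  have aA : `|a| <= `|a0| + 1.
    by rewrite -[a](subrK a0) (le_trans (ler_normD _ _))// addrC lerD2l ltW.
  have a0A : `|a0| <= `|a0| + 1 by rewrite lerDl.
  rewrite /M mulrA; apply: (normX_sub_le b0 b4m) => //.
  + by rewrite mulr_ge0// addr_ge0.
  + by rewrite /r; lra.
  + exact: prof_Ck1.
  + exact: prof_Ck1.
  + move=> x; apply: le_trans (uC _ _ x aA a0A) _.
    rewrite ler_wpM2r ?(ltW (decay_gt0 _ _))// mulrC ler_wpM2l// lerDl//.
  + move=> i x; rewrite !partial_prof; try exact: half_sign_sqr.
    apply: le_trans (duC _ _ i x aA a0A) _.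
    rewrite ler_wpM2r ?(ltW (decay_gt0 _ _))// mulrC ler_wpM2l// lerDr//.
- exact: cvg_cst.
- have : `|a - a0| * M @[a --> a0] --> `|a0 - a0| * M.
    apply: cvgM; last exact: cvg_cst.
    by apply: cvg_norm; apply: cvgB; [exact: cvg_id|exact: cvg_cst].
  rewrite subrr normr0 mul0r => h; apply: cvg_EFin h; exact: nearW.
Unshelve. all: by end_near. Qed.

(** Two unit coordinate vectors, one in each half, have the same norm, but [den] takes the values 2
    - 2a + a^2 and 2 + 2a + a^2 there. *)
Lemma prof_nonradial a : a != 0 -> ~ radial (prof eps a m).
Proof.
have N4' := N4.
move=> an0 rad.
have h0 : (0 < N./2)%N by rewrite half_gt0 -(ltr_nat R); lra.
pose i1 : 'I_N := widen_ord (@fst_half_subproof N) (Ordinal h0).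
pose i2 : 'I_N := Ordinal (@snd_half_subproof N (Ordinal h0)).
have qe c i : quad c (delta_mx 0 i : 'rV[R]_N) = c i.
  rewrite /quad (bigD1 i)//= mxE !eqxx expr1n mulr1 big1 ?addr0// => j ji.
  by rewrite mxE (negbTE ji) andbF expr0n mulr0.
have re i : rho (delta_mx 0 i : 'rV[R]_N) = 1 by rewrite rho_quad qe.
have de i : den eps a (delta_mx 0 i : 'rV[R]_N) = 2 - 2 * a * eps i + a ^+ 2.
  by rewrite /den re qe; ring.
have := rad (delta_mx 0 i1) (delta_mx 0 i2).
rewrite /enorm -!/(rho _) !re => /(_ erefl); rewrite /prof !powRN => /invr_inj.
have mgt0 : (0 : R) < m by lra.
(* As [m] is positive, equal powers of nonnegative numbers have equal bases. *)
move=> /(powR_injective mgt0); rewrite !nnegrE.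
have dge x : 0 <= den eps a x.
  by apply/ltW/den_gt0; exact: half_sign_sqr.
move=> /(_ (dge _) (dge _)); rewrite !de half_sign_fst half_sign_snd.
by move=> e; move/eqP: an0; apply; lra.
Qed.

Lemma prof0 : prof eps 0 m = @U2 R N.
Proof.
apply/funext => x; rewrite /prof /U2; congr (_ `^ _).
rewrite /den -enorm_sqr -exprM mulr0 mul0r subr0 expr0n addr0.
by [].
Qed.

End branch.

Theorem proposition1p7 (R : realType) (N : nat) (hN4 : (4 <= N)%N)
    (hNeven : ~~ odd N) (beta : R)
    (hbeta_lo : N%:R / (N%:R + 2) * (N%:R - 2) < beta)
    (hbeta_hi : beta < N%:R - 2) :
  (forall a : R, solution (@u_branch R N a)) /\
  bifurcating_branch beta (@u_branch R N) (@U2 R N).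
Proof.
have {hN4} N4 : (4 : R) <= N%:R by rewrite (ler_nat _ 4).
have b0 : 0 <= beta.
  apply: le_trans (ltW hbeta_lo); apply: mulr_ge0; last by clear hNeven; lra.
  by rewrite divr_ge0// addr_ge0.
have bN := ltW hbeta_hi.
have E : @u_branch R N = fun a => prof (@half_sign R N) a ((N%:R - 2) / 4).
  by apply/funext => a; exact: u_branchE.
rewrite E; split; first by move=> a; exact: (solution_prof N4).
split.
- by move=> a; split; [exact: (solution_prof N4)|exact: spaceX_prof].
- by move=> a0; exact: prof_cvg.
- exact: prof0.
- by move=> a a0; exact: prof_nonradial.
Qed.
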